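(* Let $\mathcal{X}$ be a Hilbert module over a pro-$C^*$-algebra $\mathcal{A}$, and let $K\in Hom^*_{\mathcal{A}}(\mathcal{X})$ be uniformly bounded with $Ran(K)$ dense in $\mathcal{X}$. Let $\{\xi_i\}_{i\in I}$ be a $K$-frame for $\mathcal{X}$ and let $T\in Hom^*_{\mathcal{A}}(\mathcal{X})$ be uniformly bounded with closed range. If $\{T\xi_i\}_{i\in I}$ is a $K$-frame for $\mathcal{X}$, then $T$ is surjective.
   Context: A pro-$C^*$-algebra $\mathcal{A}$ is a complete Hausdorff topological $*$-algebra whose topology is given by its continuous $C^*$-seminorms $S(\mathcal{A})$. A Hilbert $\mathcal{A}$-module $\mathcal{X}$ is a left $\mathcal{A}$-module with an $\mathcal{A}$-valued inner product, complete for $\bar p_{\mathcal{X}}(\xi)=\sqrt{p(\langle\xi,\xi\rangle)}$. $Hom^*_{\mathcal{A}}(\mathcal{X})$ denotes adjointable bounded $\mathcal{A}$-module maps; $T$ is uniformly bounded if there is a single $C>0$ with $\bar p_{\mathcal{X}}(T\xi)\le C\bar p_{\mathcal{X}}(\xi)$ for all $p,\xi$. A sequence $\{\xi_i\}_{i\in I}$ ($I$ countable) is a $K$-frame for $\mathcal{X}$ if $\sum_i\langle\xi,\xi_i\rangle\langle\xi_i,\xi\rangle$ converges in $\mathcal{A}$ and there are $A,B>0$ with $A\langle K^*\xi,K^*\xi\rangle\le\sum_i\langle\xi,\xi_i\rangle\langle\xi_i,\xi\rangle\le B\langle\xi,\xi\rangle$ for all $\xi\in\mathcal{X}$. *)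

(* Defs.v *)
From HB Require Import structures.
From mathcomp Require Import all_boot all_order all_algebra.
From mathcomp Require Import reals.
From mathcomp Require Import complex.
Set Implicit Arguments. Unset Strict Implicit. Unset Printing Implicit Defensive.
Import Order.TTheory GRing.Theory Num.Theory.
Local Open Scope ring_scope.

Definition normC (R : realType) (c : R[i]) : R := ComplexField.Normc.normc c.

Section ProCStar.
Variable R : realType.
Local Notation C := R[i].

(* A (possibly non-unital) complex *-algebra: a C-vector space A with  *)
(* multiplication mul and involution star; its topology is generated   *)
(* by a family (p s)_{s : S} of C*-seminorms.                          *)
Variable A : lmodType C.
Variable mul : A -> A -> A.
Variable star : A -> A.

Definition is_cstar_seminorm (q : A -> R) : Prop :=
  [/\ forall a, 0 <= q a,
      forall a b, q (a + b) <= q a + q b,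
      forall (c : C) a, q (c *: a) = normC c * q a,
      forall a b, q (mul a b) <= q a * q b
    & forall a, q (mul (star a) a) = q a ^+ 2].

Definition is_star_algebra : Prop :=
  [/\ [/\ forall a b c, mul a (mul b c) = mul (mul a b) c,
      forall a b c, mul (a + b) c = mul a c + mul b c,
      forall a b c, mul a (b + c) = mul a b + mul a c,
      forall (k : C) a b, mul (k *: a) b = k *: mul a b
    & forall (k : C) a b, mul a (k *: b) = k *: mul a b] &
   [/\ forall a, star (star a) = a,
       forall a b, star (a + b) = star a + star b,
       forall (k : C) a, star (k *: a) = conjc k *: star a
     & forall a b, star (mul a b) = mul (star b) (star a)]].

Variable S : Type.
Variable p : S -> A -> R.

(* S(A): the continuous C*-seminorms, i.e. the C*-seminorms that are    *)
(* continuous for the topology generated by the family p, i.e. bounded *)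
(* by a multiple of a finite sum of members of the family.             *)
Definition SA (q : A -> R) : Prop :=
  is_cstar_seminorm q /\
  exists (l : seq S) (c : R), forall a, q a <= c * \sum_(s <- l) p s a.

Definition directed (D : Type) (le : D -> D -> Prop) : Prop :=
  [/\ inhabited D, forall d, le d d,
      forall d1 d2 d3, le d1 d2 -> le d2 d3 -> le d1 d3
    & forall d1 d2, exists d3, le d1 d3 /\ le d2 d3].

(* Generic notions for a space V whose topology is given by the family *)
(* of seminorms nrm q, indexed by the q in S(A).                       *)
Section Seminormed.
Variable V : zmodType.
Variable nrm : (A -> R) -> V -> R.

Definition net_converges (D : Type) (le : D -> D -> Prop) (x : D -> V) (v : V) :=
  forall q, SA q -> forall eps : R, 0 < eps ->
    exists d0, forall d, le d0 d -> nrm q (x d - v) < eps.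

Definition net_cauchy (D : Type) (le : D -> D -> Prop) (x : D -> V) :=
  forall q, SA q -> forall eps : R, 0 < eps ->
    exists d0, forall d1 d2, le d0 d1 -> le d0 d2 -> nrm q (x d1 - x d2) < eps.

Definition complete_hausdorff : Prop :=
  (forall v, (forall q, SA q -> nrm q v = 0) -> v = 0) /\
  (forall (D : Type) (le : D -> D -> Prop) (x : D -> V),
      directed le -> net_cauchy le x -> exists v, net_converges le x v).

Definition in_closure (P : V -> Prop) (v : V) : Prop :=
  forall q, SA q -> forall eps : R, 0 < eps ->
    exists w, P w /\ nrm q (v - w) < eps.
End Seminormed.

Definition is_pro_cstar_algebra : Prop :=
  [/\ is_star_algebra,
      forall s, is_cstar_seminorm (p s)
    & complete_hausdorff (fun q a => q a)].

Definition positive (a : A) : Prop := exists b, a = mul (star b) b.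
Definition leA (a b : A) : Prop := positive (b - a).

Variable X : lmodType C.
Variable act : A -> X -> X.
Variable ip : X -> X -> A.

Definition qX (q : A -> R) (x : X) : R := Num.sqrt (q (ip x x)).

Definition is_hilbert_module : Prop :=
  [/\ [/\ forall a x y, act a (x + y) = act a x + act a y,
          forall a b x, act (a + b) x = act a x + act b x,
          forall a b x, act (mul a b) x = act a (act b x),
          forall (k : C) a x, act (k *: a) x = k *: act a x
        & forall (k : C) a x, act a (k *: x) = k *: act a x],
      [/\ [/\ forall x y z, ip (x + y) z = ip x z + ip y z,
          forall (k : C) x y, ip (k *: x) y = k *: ip x y,
          forall a x y, ip (act a x) y = mul a (ip x y)
        & forall x y, star (ip x y) = ip y x],
          forall x, positive (ip x x)
        & forall x, ip x x = 0 -> x = 0]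
    & complete_hausdorff qX].

Definition is_adjoint (T Ts : X -> X) : Prop :=
  forall x y, ip (T x) y = ip x (Ts y).

Definition in_Hom (T : X -> X) : Prop :=
  [/\ forall x y, T (x + y) = T x + T y,
      forall (k : C) x, T (k *: x) = k *: T x,
      forall a x, T (act a x) = act a (T x),
      forall q, SA q -> exists c : R, forall x, qX q (T x) <= c * qX q x
    & exists Ts, is_adjoint T Ts].

Definition unif_bounded (T : X -> X) : Prop :=
  exists c : R, 0 < c /\ forall q, SA q -> forall x, qX q (T x) <= c * qX q x.

Definition range (T : X -> X) (y : X) : Prop := exists x, T x = y.

Definition dense_range (T : X -> X) : Prop := forall y, in_closure qX (range T) y.

Definition closed_range (T : X -> X) : Prop :=
  forall y, in_closure qX (range T) y -> range T y.

(* Unconditional convergence of sum_{i in I} f i in A: the net of      *)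
(* finite partial sums (finite subsets ordered by inclusion) converges.*)
Definition sum_converges_to (I : countType) (f : I -> A) (s : A) : Prop :=
  forall q, SA q -> forall eps : R, 0 < eps ->
    exists F0 : seq I, forall F : seq I, uniq F -> {subset F0 <= F} ->
      q (\sum_(i <- F) f i - s) < eps.

(* K-frames (Ks is the adjoint K^* of K). *)
Definition is_K_frame (K Ks : X -> X) (I : countType) (xi : I -> X) : Prop :=
  exists (Alo Bup : R), 0 < Alo /\ 0 < Bup /\
  forall x, exists s : A,
    [/\ sum_converges_to (fun i => mul (ip x (xi i)) (ip (xi i) x)) s,
        leA ((Alo%:C)%C *: ip (Ks x) (Ks x)) s
      & leA s ((Bup%:C)%C *: ip x x)].

End ProCStar.

(* Main.v *)
(* Since [T xi] is a K-frame and [xi] has an upper frame bound, comparing the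
   two frame sums gives [Alo <K^* v, K^* v> <= Bup <T^* v, T^* v>], that is,
   [K K^* <= (Bup / Alo) T T^*].  This already forces the range of [K] into the
   closure of the range of [T], seminorm by seminorm: the iterates
   [u_k = (1 - s T T^* )^k K x] differ from [K x] by elements of the range of
   [T], the telescoped energy identity makes [sum_k <T^* u_k, T^* u_k>] at most
   of order [1/s], hence so is [sum_k <K^* u_k, K^* u_k>], and
   [<u_k, u_k> = <x, K^* u_{2k}>] makes the average of the [u_k] small.  So the
   range of [T] is dense and closed.

   The only fact about C*-seminorms that this uses is that a seminorm is monotone
   on sums of elements [b^* b].  It is obtained without completeness or spectral
   theory, from polynomial approximations of square roots in the unitization. *)
From HB Require Import structures.
Require Import Defs.
From mathcomp Require Import all_boot all_order all_algebra.
From mathcomp Require Import classical_sets reals complex.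
From mathcomp Require Import ring lra.
Set Implicit Arguments. Unset Strict Implicit. Unset Printing Implicit Defensive.
Import Order.TTheory GRing.Theory Num.Theory.
Local Open Scope ring_scope.

(** * Deciding linear identities in modules by reflection *)

Section LinearExpressions.
Variables (K : pzRingType) (V : lmodType K).

Inductive lexp : Type :=
  | LAtom of nat | LZero | LAdd of lexp & lexp | LOpp of lexp
  | LScale of K & lexp.

Fixpoint lexp_eval (env : seq V) (e : lexp) : V :=
  match e with
  | LAtom n => nth 0 env n
  | LZero => 0
  | LAdd e1 e2 => lexp_eval env e1 + lexp_eval env e2
  | LOpp e1 => - lexp_eval env e1
  | LScale k e1 => k *: lexp_eval env e1
  end.

Fixpoint lexp_coef (e : lexp) (i : nat) : K :=
  match e with
  | LAtom n => if eqn i n then 1 else 0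
  | LZero => 0
  | LAdd e1 e2 => lexp_coef e1 i + lexp_coef e2 i
  | LOpp e1 => - lexp_coef e1 i
  | LScale k e1 => k * lexp_coef e1 i
  end.

(** A recursive conjunction rather than a bounded quantifier: on a concrete environment it computes
    to finitely many scalar equations, which [lmod] splits. *)
Fixpoint lexp_coef_eq (n : nat) (e1 e2 : lexp) : Prop :=
  if n is m.+1 then lexp_coef e1 m = lexp_coef e2 m /\ lexp_coef_eq m e1 e2
  else True.

Lemma lexp_evalE env e :
  lexp_eval env e = \sum_(i < size env) lexp_coef e i *: nth 0 env i.
Proof.
elim: e => [n||e1 IH1 e2 IH2|e1 IH1|k e1 IH1] /=.
- have [ltn|gen] := ltnP n (size env).
    rewrite (bigD1 (Ordinal ltn)) //= big1 => [|i ne].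
      by rewrite [eqn n n](eqxx n) scale1r addr0.
    rewrite eqnE ifF ?scale0r //; apply/negbTE; move: ne; apply: contra.
    by move=> /eqP eq; apply/eqP/val_inj.
  rewrite nth_default // big1 // => i _; rewrite eqnE ifF ?scale0r //.
  by apply/negbTE; rewrite neq_ltn (leq_trans (ltn_ord i) gen).
- by rewrite big1 // => i _; rewrite scale0r.
- by rewrite IH1 IH2 -big_split; apply: eq_bigr => i _; rewrite scalerDl.
- by rewrite IH1 -sumrN; apply: eq_bigr => i _; rewrite scaleNr.
- by rewrite IH1 scaler_sumr; apply: eq_bigr => i _; rewrite scalerA.
Qed.

Lemma lexp_eq env e1 e2 :
  lexp_coef_eq (size env) e1 e2 -> lexp_eval env e1 = lexp_eval env e2.
Proof.
have H n i : lexp_coef_eq n e1 e2 -> (i < n)%N -> lexp_coef e1 i = lexp_coef e2 i.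
  elim: n => //= n IH [eqn Hn]; rewrite ltnS leq_eqVlt => /predU1P[->//|].
  exact: IH.
by move=> Hc; rewrite !lexp_evalE; apply: eq_bigr => i _; rewrite (H _ _ Hc).
Qed.

End LinearExpressions.

Ltac lmod_index x env :=
  lazymatch env with
  | cons x _ => constr:(O)
  | cons _ ?env' => let n := lmod_index x env' in constr:(S n)
  end.

Ltac lmod_add x env :=
  lazymatch env with
  | nil => constr:(cons x nil)
  | cons x _ => env
  | cons ?y ?env' => let e := lmod_add x env' in constr:(cons y e)
  end.

(* Products and units reached through different inheritance paths are rebuilt
   so that equal atoms become syntactically equal. *)
Ltac lmod_canon V t :=
  lazymatch t with
  | ?a * ?b => let x := lmod_canon V a in let y := lmod_canon V b in
      constr:(@GRing.mul V x y)
  | 1 => constr:(@GRing.one V)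
  | _ => t
  end.

Ltac lmod_atoms V t env :=
  lazymatch t with
  | 0 => env
  | ?a + ?b => let e := lmod_atoms V a env in lmod_atoms V b e
  | - ?a => lmod_atoms V a env
  | _ *: ?a => lmod_atoms V a env
  | _ => let u := lmod_canon V t in lmod_add u env
  end.

Ltac lmod_reify V K t env :=
  lazymatch t with
  | 0 => constr:(LZero K)
  | ?a + ?b => let x := lmod_reify V K a env in let y := lmod_reify V K b env in
      constr:(LAdd x y)
  | - ?a => let x := lmod_reify V K a env in constr:(LOpp x)
  | ?k *: ?a => let x := lmod_reify V K a env in constr:(LScale (k : K) x)
  | _ => let u := lmod_canon V t in
      let n := lmod_index u env in constr:(LAtom K n)
  end.

Ltac complex_eq :=
  first [by ring | apply/eqP; rewrite eq_complex /=; apply/andP; split; apply/eqP;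
                   first [by ring | by field]].

(* Decides equality of linear combinations in an lmodType over [K = R[i]]. *)
Ltac lmod V :=
  lazymatch goal with
  | |- ?l = ?r =>
    let K := lazymatch type of V with
             | lmodType ?K => constr:(K) | algType ?K => constr:(K) end in
    let env := lmod_atoms V l (@nil V) in
    let env := lmod_atoms V r env in
    let e1 := lmod_reify V K l env in
    let e2 := lmod_reify V K r env in
    change (lexp_eval (V := V) env e1 = lexp_eval (V := V) env e2);
    apply: lexp_eq; rewrite /=; repeat (split; [complex_eq|]); exact: Logic.I
  end.

(** Once products are expanded and scalars pulled out, a noncommutative identity is linear in its
    monomials, which serve as atoms for [lmod]. *)
Ltac ncring E :=
  do 30? rewrite ?(mulrDl, mulrDr, mulNr, mulrN, mulr1, mul1r, mulr0, mul0r, mulrA)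
                 -?scalerAl -?scalerAr;
  lmod E.

Local Notation rc r := (real_complex _ r).

(** * Scalar estimates *)

Section RealLemmas.
Variable R : realType.
Implicit Types (x y r D e : R).

Lemma normC_real (r : R) : normC (rc r) = `|r|.
Proof. by rewrite /normC /= expr0n addr0 sqrtr_sqr. Qed.

Lemma normC_i : normC ('i%C : R[i]) = 1.
Proof. by rewrite /normC /= expr0n add0r expr1n sqrtr1. Qed.

Lemma conjc_i : conjc ('i%C : R[i]) = - 'i%C.
Proof. by complex_eq. Qed.

Lemma bernoulli_ineq x n : 0 <= x -> 1 + n%:R * x <= (1 + x) ^+ n.
Proof.
move=> x0; elim: n => [|n IH]; first by rewrite mul0r addr0 expr0.
rewrite exprS -natr1; apply: le_trans (ler_wpM2l _ IH); last lra.
have n0 : 0 <= n%:R :> R by exact: ler0n.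
by have := mulr_ge0 n0 (mulr_ge0 x0 x0); lra.
Qed.

(** If [r = 1 + d] with [d > 0], squaring Bernoulli's inequality makes [r ^+ (2 n)] grow at least
    quadratically in [n], against a linear bound. *)
Lemma expr_pow2_le1 r D : 0 <= D ->
  (forall k, r ^+ (2 ^ k)%N <= 1 + (2 ^ k)%:R * D) -> r <= 1.
Proof.
move=> D0 H; rewrite leNgt; apply/negP => r1.
pose d := r - 1; have d0 : 0 < d by rewrite subr_gt0.
(* With [n = 2 ^ k] above [2 D / d ^+ 2], the square of [n d] exceeds [2 n D], which contradicts the
   bound at exponent [2 n]. *)
pose k := Num.bound (2 * D / d ^+ 2).
have Hk : 2 * D / d ^+ 2 < (2 ^ k)%:R.
  apply: (@lt_trans _ _ k%:R); last by rewrite ltr_nat ltn_expl.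
  by apply/archi_boundP/divr_ge0; [rewrite mulr_ge0|exact: sqr_ge0].
move: Hk (H k.+1); set n := (2 ^ k)%N => Hk.
rewrite expnSr -/n natrM exprM.
have -> : r = 1 + d by rewrite addrC subrK.
have n0 : 0 <= n%:R :> R by exact: ler0n.
have := @bernoulli_ineq d n (ltW d0).
have nd0 : 0 <= n%:R * d by rewrite mulr_ge0 // ltW.
have npos : 0 < n%:R :> R by rewrite ltr0n expn_gt0.
move: Hk; rewrite ltr_pdivrMr ?exprn_gt0 // => Hk.
move: nd0; set z := (1 + d) ^+ n; set nn := n%:R in Hk npos * => nd0 Hz Hle.
have : (1 + nn * d) ^+ 2 <= z ^+ 2 by rewrite ler_pXn2r ?nnegrE //; lra.
have : nn * (2 * D) < nn * (nn * d ^+ 2) by rewrite ltr_pM2l.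
lra.
Qed.

End RealLemmas.

(** * Elementary properties of C*-seminorms *)

Section SeminormTheory.
Variables (R : realType) (A : lmodType R[i]).
Variables (mul : A -> A -> A) (star : A -> A) (q : A -> R).
Hypothesis starA : is_star_algebra mul star.
Hypothesis qP : is_cstar_seminorm mul star q.

Lemma cs_ge0 a : 0 <= q a. Proof. by case: qP. Qed.
Lemma cs_D a b : q (a + b) <= q a + q b. Proof. by case: qP. Qed.
Lemma cs_Z c a : q (c *: a) = normC c * q a. Proof. by case: qP. Qed.
Lemma cs_M a b : q (mul a b) <= q a * q b. Proof. by case: qP. Qed.
Lemma cs_star2 a : q (mul (star a) a) = q a ^+ 2. Proof. by case: qP. Qed.

Lemma cs_Zr (r : R) a : q (rc r *: a) = `|r| * q a.
Proof. by rewrite cs_Z normC_real. Qed.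

Lemma cs_Zr_ge0 (r : R) a : 0 <= r -> q (rc r *: a) = r * q a.
Proof. by move=> r0; rewrite cs_Zr ger0_norm. Qed.

Lemma cs_Zi a : q ('i%C *: a) = q a.
Proof. by rewrite cs_Z normC_i mul1r. Qed.

Lemma cs_0 : q 0 = 0.
Proof. by rewrite -(scale0r (0 : A)) (cs_Zr 0) normr0 mul0r. Qed.

Lemma cs_N a : q (- a) = q a.
Proof.
have -> : - a = rc (-1) *: a by rewrite rmorphN1 scaleN1r.
by rewrite cs_Zr normrN1 mul1r.
Qed.

Lemma cs_B a b : q (a - b) <= q a + q b.
Proof. by apply: le_trans (cs_D _ _) _; rewrite cs_N. Qed.

(** The C*-identity and submultiplicativity give [q b ^+ 2 <= q (star b) * q b]; cancel [q b], then
    exchange [b] and [star b]. *)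
Lemma cs_star a : q (star a) = q a.
Proof.
have [_ [starK _ _ _]] := starA.
suff le1 b : q b <= q (star b).
  by apply/le_anti; rewrite le1 andbT -{2}(starK a) le1.
have [->|qb0] := eqVneq (q b) 0; first exact: cs_ge0.
have qb : 0 < q b by rewrite lt_def qb0 cs_ge0.
by rewrite -(ler_pM2r qb) -expr2 -cs_star2 cs_M.
Qed.

End SeminormTheory.

(** * C*-seminorms on unital algebras *)

Section CStarSeminorm.
Variables (R : realType) (E : algType R[i]) (st : E -> E) (N : E -> R).
Hypothesis stP : is_star_algebra *%R st.
Hypothesis NP : is_cstar_seminorm *%R st N.
Hypothesis N1 : N 1 <= 1.

Let N_ge0 := cs_ge0 NP.
Let N_D := cs_D NP.
Let N_M := cs_M NP.
Let N_B := cs_B NP.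
Let N_N := cs_N NP.
Let N_st := cs_star stP NP.
Let N_star2 := cs_star2 NP.
Let N_Zr := cs_Zr_ge0 NP.

Lemma stK a : st (st a) = a. Proof. by have [_ [h _ _ _]] := stP; exact: h. Qed.
Lemma stD a b : st (a + b) = st a + st b. Proof. by have [_ [_ h _ _]] := stP; exact: h. Qed.
Lemma stZ k a : st (k *: a) = conjc k *: st a. Proof. by have [_ [_ _ h _]] := stP; exact: h. Qed.
Lemma stM a b : st (a * b) = st b * st a. Proof. by have [_ [_ _ _ h]] := stP; exact: h. Qed.

Lemma stZr r a : st (rc r *: a) = rc r *: st a.
Proof. by rewrite stZ conjc_real. Qed.

Lemma stN a : st (- a) = - st a.
Proof. by rewrite -scaleN1r stZ rmorphN1 scaleN1r. Qed.

Lemma stB a b : st (a - b) = st a - st b.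
Proof. by rewrite stD stN. Qed.

Lemma st0 : st 0 = 0.
Proof. by rewrite -[in LHS](scale0r (0 : E)) stZ conjc0 scale0r. Qed.

Lemma st1 : st 1 = 1.
Proof. by rewrite -[LHS]mulr1 -{2}(stK 1) -stM mulr1 stK. Qed.

Lemma stX a n : st a = a -> st (a ^+ n) = a ^+ n.
Proof.
by move=> sa; elim: n => [|n IH]; [rewrite expr0 st1|rewrite exprS stM IH sa -exprSr -exprS].
Qed.

Lemma N_sq k : st k = k -> N (k * k) = N k ^+ 2.
Proof. by move=> sk; rewrite -N_star2 sk. Qed.

Lemma N_X a n : N (a ^+ n) <= N a ^+ n.
Proof.
elim: n => [|n IH]; first by rewrite !expr0.
by rewrite !exprS; apply: le_trans (N_M _ _) _; rewrite ler_wpM2l.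
Qed.

Lemma N_pow2 a k : st a = a -> N (a ^+ (2 ^ k)) = N a ^+ (2 ^ k).
Proof.
move=> sa; elim: k => [|k IH]; first by rewrite !expr1.
by rewrite expnSr !exprM expr2 N_sq ?stX // IH.
Qed.

Lemma N_scalar r : 0 <= r -> N (rc r *: 1) <= r.
Proof. by move=> r0; rewrite N_Zr // -[leRHS]mulr1 ler_wpM2l. Qed.

(** * Approximate square roots *)

(* [1 - sqrt_iter m n] converges to the square root of [1 - m]; the scalar
   iteration [sqrt_iter_bound], started at [m = 1], dominates it. *)
Fixpoint sqrt_iter (m : E) (n : nat) : E :=
  if n is k.+1 then rc (2^-1 : R) *: (m + sqrt_iter m k * sqrt_iter m k) else 0.

Fixpoint sqrt_iter_bound (n : nat) : R :=
  if n is k.+1 then 2^-1 * (1 + sqrt_iter_bound k ^+ 2) else 0.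

Lemma sqrt_iter_bound01 n : 0 <= sqrt_iter_bound n <= 1.
Proof.
elim: n => [|n /andP[IH0 IH1]] /=; first by rewrite lexx ler01.
have := sqr_ge0 (sqrt_iter_bound n).
by have := mulr_ge0 IH0 (_ : 0 <= 1 - sqrt_iter_bound n); rewrite subr_ge0 => /(_ IH1); lra.
Qed.

(** A sequence that starts at 0 and stays below 1 cannot increase by more than [e] at each of more
    than [1 / e] steps. *)
Lemma sqrt_iter_bound_gap e : 0 < e ->
  exists n, sqrt_iter_bound n.+1 - sqrt_iter_bound n <= e.
Proof.
move=> e0; set f := sqrt_iter_bound.
have H n : (exists i, f i.+1 - f i <= e) \/ n%:R * e <= f n.
  elim: n => [|n [|IH]]; [by right; rewrite mul0r|by left|].
  have [le|lt] := leP (f n.+1 - f n) e; first by left; exists n.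
  by right; rewrite -natr1; lra.
have [//|] := H (Num.bound e^-1).
have := archi_boundP (ltW (_ : 0 < e^-1)); rewrite invr_gt0 => /(_ e0).
rewrite -(ltr_pM2r e0) mulVf ?gt_eqF // => lt1 le1.
by have /andP[_] := sqrt_iter_bound01 (Num.bound e^-1); rewrite -/f; lra.
Qed.

Lemma sqrt_iter_le m n : N m <= 1 -> N (sqrt_iter m n) <= sqrt_iter_bound n.
Proof.
move=> m1; elim: n => [|n IH] /=; first by rewrite (cs_0 NP).
rewrite N_Zr ?invr_ge0 // ler_wpM2l ?invr_ge0 //.
apply: le_trans (N_D _ _) _; rewrite lerD // expr2.
by apply: le_trans (N_M _ _) _; rewrite ler_pM.
Qed.

(** The difference [z z - y y = z (z - y) + (z - y) y] needs no commutation, and its estimate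
    matches the scalar difference of squares exactly. *)
Lemma sqrt_iter_gap m n : N m <= 1 ->
  N (sqrt_iter m n.+1 - sqrt_iter m n) <=
  sqrt_iter_bound n.+1 - sqrt_iter_bound n.
Proof.
move=> m1; elim: n => [|n IH].
  rewrite /= mulr0 addr0 subr0 N_Zr ?invr_ge0 // expr0n addr0 subr0.
  by rewrite ler_wpM2l ?invr_ge0.
move: IH; have := sqrt_iter_le n m1; have := sqrt_iter_le n.+1 m1.
have /andP[] := sqrt_iter_bound01 n; have /andP[] := sqrt_iter_bound01 n.+1.
have iterS k : sqrt_iter m k.+1 = rc (2^-1 : R) *: (m + sqrt_iter m k * sqrt_iter m k) by [].
have boundS k : sqrt_iter_bound k.+1 = 2^-1 * (1 + sqrt_iter_bound k ^+ 2) by [].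
rewrite (iterS n.+1) (boundS n.+1) {5}(iterS n) (boundS n).
move: (sqrt_iter m n.+1) (sqrt_iter m n) (sqrt_iter_bound n) => z y a.
set b := 2^-1 * _ => b0 b1 a0 a1 Nz Ny Ngap.
have -> : rc (2^-1 : R) *: (m + z * z) - rc (2^-1 : R) *: (m + y * y) =
   rc (2^-1 : R) *: (z * (z - y) + (z - y) * y) by ncring E.
rewrite N_Zr ?invr_ge0 //.
have H1 : N (z * (z - y)) <= b * (b - a).
  by apply: le_trans (N_M _ _) _; rewrite ler_pM.
have H2 : N ((z - y) * y) <= (b - a) * a.
  by apply: le_trans (N_M _ _) _; rewrite ler_pM.
have bE : b = 2^-1 * (1 + a ^+ 2) by [].
by have := N_D (z * (z - y)) ((z - y) * y); lra.
Qed.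

(** For an iterate [y], the error [(1 - y)^2 - (1 - m)] is twice the next increment, so one small
    gap suffices and no limit is taken. Iterates are polynomials in [m], whence the commutation
    clause. *)
Lemma approx_sqrt m e : st m = m -> N m <= 1 -> 0 < e ->
  exists y, [/\ st y = y, N y <= 1, N ((1 - y) * (1 - y) - (1 - m)) <= e
    & forall z, GRing.comm z m -> GRing.comm z y].
Proof.
move=> sm m1 e0.
have e2 : 0 < e / 2 by rewrite divr_gt0.
have [n Hn] := sqrt_iter_bound_gap e2.
exists (sqrt_iter m n); split.
- elim: n {Hn} => [|n IH] /=; first exact: st0.
  by rewrite stZr stD stM IH sm.
- apply: le_trans (sqrt_iter_le n m1) _.
  by have /andP[] := sqrt_iter_bound01 n.
- have -> : (1 - sqrt_iter m n) * (1 - sqrt_iter m n) - (1 - m) =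
    rc (2 : R) *: (sqrt_iter m n.+1 - sqrt_iter m n) by rewrite /=; ncring E.
  rewrite N_Zr //; have := sqrt_iter_gap n m1; lra.
- move=> z zm; elim: n {Hn} => [|n IH] /=; first exact: commr0.
  rewrite /GRing.comm -scalerAr -scalerAl; congr (_ *: _).
  by apply: commrD => //; apply: commrM.
Qed.

Lemma N_im_le k l : st k = k -> st l = l -> N l <= N (k + 'i%C *: l).
Proof.
move=> sk sl; set v := k + _.
have -> : l = - ((rc (2^-1 : R) *: ('i%C *: (v - st v)))).
  by rewrite /v stD stZ sk sl conjc_i; lmod E.
rewrite N_N N_Zr ?invr_ge0 // (cs_Zi NP).
by have := N_B v (st v); rewrite N_st; lra.
Qed.

(** Let [l] be an approximate root of [1 - k k] commuting with [k]. Then [k + i l] is nearly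
    unitary, since its C*-square is [k k + l l], close to 1; its imaginary part [l] is therefore
    nearly contractive. *)
Lemma N_1subsq_le1 k : st k = k -> N k <= 1 -> N (1 - k * k) <= 1.
Proof.
move=> sk k1; apply/ler_addgt0Pr => e e0.
have e2 : 0 < e / 2 by rewrite divr_gt0.
have Nkk : N (k * k) <= 1 by rewrite N_sq // expr_le1.
have [|y [sy y1 yE yC]] := approx_sqrt _ Nkk e2; first by rewrite stM sk.
have yk : GRing.comm k y by apply: yC; apply: commrM.
have sl : st (1 - y) = 1 - y by rewrite stB st1 sy.
have lk : k * (1 - y) = (1 - y) * k by rewrite mulrBr mulrBl mulr1 mul1r yk.
move: (1 - y) yE sl lk => l lE sl lk.
have Hl : N (l * l) <= N (k * k + l * l).
  have -> : k * k + l * l = st (k + 'i%C *: l) * (k + 'i%C *: l).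
    rewrite stD stZ sk sl conjc_i.
    have -> : (k + - 'i%C *: l) * (k + 'i%C *: l) =
      k * k + l * l + 'i%C *: (k * l - l * k) by ncring E.
    by rewrite lk subrr scaler0 addr0.
  by rewrite N_star2 N_sq // ler_pXn2r ?nnegrE // N_im_le.
have -> : 1 - k * k = l * l - (l * l - (1 - k * k)) by lmod E.
have H2 : N (k * k + l * l) <= 1 + e / 2.
  have -> : k * k + l * l = 1 + (l * l - (1 - k * k)) by lmod E.
  by apply: le_trans (N_D _ _) _; rewrite lerD.
by have := N_B (l * l) (l * l - (1 - k * k)); lra.
Qed.

(** For [v = s + i k] with [s = N k], the C*-square is [s^2 + k k], while [v v] has imaginary part
    [2 s k], of seminorm [2 s^2]. This replaces the fact that the norm of [k k] lies in its
    spectrum. *)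
Lemma N_scalar_sq_ge k : st k = k -> 2 * N k ^+ 2 <= N (rc (N k ^+ 2) *: 1 + k * k).
Proof.
move=> sk; set s := N k; set v := rc s *: 1 + 'i%C *: k.
have s0 : 0 <= s by exact: N_ge0.
have sv : st v * v = rc (s ^+ 2) *: 1 + k * k.
  by rewrite /v stD stZr stZ st1 sk conjc_i; ncring E.
have vv : v * v = (rc (s ^+ 2) *: 1 - k * k) + 'i%C *: (rc (2 * s) *: k).
  by rewrite /v; ncring E.
rewrite -sv N_star2; apply: le_trans (_ : N (v * v) <= _); last first.
  by rewrite expr2 N_M.
rewrite vv; apply: le_trans (N_im_le _ _); rewrite ?stB ?stZr ?stM ?st1 ?sk //.
by rewrite N_Zr ?mulr_ge0 // -/s expr2 mulrA.
Qed.

(** * Positive elements *)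

(** Approximate squares, because [E] is not assumed complete and square roots are available only up
    to [e]. *)
Definition cpos (g : E) : Prop :=
  st g = g /\ forall e, 0 < e -> exists k, st k = k /\ N (g - k * k) <= e.

Lemma cpos_sq k : st k = k -> cpos (k * k).
Proof.
move=> sk; split=> [|e e0]; first by rewrite stM sk.
by exists k; rewrite subrr (cs_0 NP) ltW.
Qed.

Lemma N_scalar_sub_sq_le s k : st k = k -> 0 < s -> N k ^+ 2 <= s ->
  N (rc s *: 1 - k * k) <= s.
Proof.
move=> sk s0 ks; pose r := (Num.sqrt s)^-1.
have sqs : Num.sqrt s ^+ 2 = s by rewrite sqr_sqrtr ?ltW.
have r0 : 0 < r by rewrite invr_gt0 sqrtr_gt0.
have sr2 : s * (r * r) = 1.
  by rewrite -expr2 exprVn sqs divff ?gt_eqF.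
have -> : rc s *: 1 - k * k = rc s *: (1 - (rc r *: k) * (rc r *: k)).
  have -> : 1 - (rc r *: k) * (rc r *: k) = 1 - rc (r * r) *: (k * k) by ncring E.
  by rewrite scalerBr scalerA -rmorphM sr2 scale1r.
rewrite N_Zr ?(ltW s0) // -[leRHS]mulr1 ler_pM2l // N_1subsq_le1 ?stZr ?sk //.
rewrite N_Zr ?(ltW r0) // -(@expr_le1 _ 2) ?mulr_ge0 ?(ltW r0) //.
by rewrite exprMn exprVn sqs mulrC ler_pdivrMr // mul1r.
Qed.

(** With [cpos_of_contr], this characterises positivity by a norm inequality. For [g] close to
    [k k], it is [N_1subsq_le1] after rescaling. *)
Lemma cpos_contr g t : cpos g -> N g <= t -> N (rc t *: 1 - g) <= t.
Proof.
move=> [sg Hg] gt; apply/ler_addgt0Pr => e e0.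
have e3 : 0 < e / 3 by rewrite divr_gt0.
have [k [sk kE]] := Hg _ e3; set d := e / 3 in e3 kE.
have t0 : 0 <= t by apply: le_trans gt.
have Nk : N k ^+ 2 <= t + d.
  rewrite -N_sq // -[k * k](subKr g).
  by apply: le_trans (N_B _ _) _; rewrite lerD.
have td0 : 0 < t + d by rewrite ltr_wpDl.
have H := N_scalar_sub_sq_le sk td0 Nk.
have -> : rc t *: 1 - g = (rc (t + d) *: 1 - k * k) - (rc d *: 1 + (g - k * k)).
  by lmod E.
have Hd := N_scalar (ltW e3).
have ed : e = 3 * d by rewrite /d; lra.
have := N_B (rc (t + d) *: 1 - k * k) (rc d *: 1 + (g - k * k)).
by have := N_D (rc d *: 1) (g - k * k); lra.
Qed.

(** Writing [g = t (1 - m)] with [m] contractive, [sqrt t] times an approximate root of [1 - m] is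
    an approximate root of [g]. *)
Lemma cpos_of_contr g t : st g = g -> 0 < t -> N (rc t *: 1 - g) <= t -> cpos g.
Proof.
move=> sg t0 gt; split=> // e e0.
have et0 : 0 < e / t by rewrite divr_gt0.
pose m := rc t^-1 *: (rc t *: 1 - g).
have sm : st m = m by rewrite stZr stB stZr st1 sg.
have m1 : N m <= 1.
  by rewrite N_Zr ?invr_ge0 ?(ltW t0) // mulrC ler_pdivrMr // mul1r.
have [y [sy _ yE _]] := approx_sqrt sm m1 et0.
exists (rc (Num.sqrt t) *: (1 - y)); split; first by rewrite stZr stB st1 sy.
have mE : rc t *: m = rc t *: 1 - g.
  by rewrite scalerA -rmorphM divff ?gt_eqF // scale1r.
have -> : g - rc (Num.sqrt t) *: (1 - y) * (rc (Num.sqrt t) *: (1 - y)) =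
   - (rc t *: ((1 - y) * (1 - y) - (1 - m))).
  rewrite -scalerAl -scalerAr scalerA -rmorphM -expr2 sqr_sqrtr ?ltW //.
  rewrite [in RHS]scalerBr [in RHS]scalerBr mE.
  by move: ((1 - y) * (1 - y)) => z; lmod E.
rewrite N_N N_Zr ?(ltW t0) //.
by move: yE; rewrite ler_pdivlMr // mulrC.
Qed.

Lemma cpos_scalar_sub r h : st h = h -> 0 < r -> N h <= r -> cpos (rc r *: 1 - h).
Proof.
move=> sh r0 hr; apply: (@cpos_of_contr _ r) => //; first by rewrite stB stZr st1 sh.
by rewrite subKr.
Qed.

(** In the norm characterisation the radii add, by the triangle inequality; the extra 1 in each
    keeps the total radius positive. *)
Lemma cposD g h : cpos g -> cpos h -> cpos (g + h).
Proof.
move=> pg ph; have [[sg _] [sh _]] := (pg, ph).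
apply: (@cpos_of_contr _ ((N g + 1) + (N h + 1))); first by rewrite stD sg sh.
  by have := N_ge0 g; have := N_ge0 h; lra.
have -> : rc ((N g + 1) + (N h + 1)) *: 1 - (g + h) =
  (rc (N g + 1) *: 1 - g) + (rc (N h + 1) *: 1 - h) by lmod E.
by apply: le_trans (N_D _ _) _; rewrite lerD // cpos_contr //; lra.
Qed.

Lemma cposZ c g : 0 <= c -> cpos g -> cpos (rc c *: g).
Proof.
move=> c0 [sg Hg]; split=> [|e e0]; first by rewrite stZr sg.
have c1 : 0 < c + 1 by lra.
(* Dividing by [c + 1] instead of [c] covers [c = 0]. *)
have [|k [sk kE]] := Hg (e / (c + 1)); first by rewrite divr_gt0.
exists (rc (Num.sqrt c) *: k); split; first by rewrite stZr sk.
rewrite -scalerAl -scalerAr scalerA -rmorphM -expr2 sqr_sqrtr // -scalerBr N_Zr //.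
move: kE; rewrite ler_pdivlMr //.
by have := N_ge0 (g - k * k); lra.
Qed.

Lemma N_scalar_pos_ge w t : st w = w ->
  2 * N w ^+ 2 - `|t - N w ^+ 2| <= N (rc t *: 1 + w * w).
Proof.
move=> sw; apply: le_trans (lerB (N_scalar_sq_ge sw) (lexx _)) _.
have -> : rc (N w ^+ 2) *: 1 + w * w =
  rc t *: 1 + w * w - rc (t - N w ^+ 2) *: 1 by lmod E.
rewrite lerBlDr; apply: le_trans (N_B _ _) _; rewrite lerD2l (cs_Zr NP).
by rewrite -[leRHS]mulr1 ler_wpM2l.
Qed.

(** For [r] just above [N (a + d)], the element [r - a = (r - (a + d)) + d] is positive, so
    [N a + a] has seminorm at most [N a + r] by [cpos_contr]. By [N_scalar_sq_ge] it has seminorm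
    about [2 N a] at least, hence [N a <= r]. *)
Lemma cpos_mono a d : cpos a -> cpos d -> N a <= N (a + d).
Proof.
move=> pa pd; apply/ler_addgt0Pr => e e0; set r := N (a + d) + e.
have [[sa Ha] [sd _]] := (pa, pd).
have r0 : 0 < r by rewrite ltr_wpDl.
have pra : cpos (rc r *: 1 - a).
  have -> : rc r *: 1 - a = (rc r *: 1 - (a + d)) + d by lmod E.
  by apply: cposD => //; apply: cpos_scalar_sub; rewrite ?stD ?sa ?sd // lerDl ltW.
have H1 : N (rc (N a) *: 1 + a) <= N a + r.
  have -> : rc (N a) *: 1 + a = rc (N a + r) *: 1 - (rc r *: 1 - a) by lmod E.
  apply: cpos_contr => //; apply: le_trans (N_B _ _) _; rewrite addrC lerD2l.
  exact/N_scalar/ltW.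
apply/ler_addgt0Pr => f f0.
have f5 : 0 < f / 5 by rewrite divr_gt0.
have [k [sk kE]] := Ha _ f5; set f' := f / 5 in f5 kE.
have fE : f = 5 * f' by rewrite /f'; lra.
have Nk1 : N a <= N k ^+ 2 + f'.
  rewrite -N_sq // -{1}[a](subrK (k * k)) addrC.
  by apply: le_trans (N_D _ _) _; rewrite lerD.
have Nk2 : N k ^+ 2 <= N a + f'.
  rewrite -N_sq // -[k * k](subKr a).
  by apply: le_trans (N_B _ _) _; rewrite lerD.
have H2 := N_scalar_pos_ge (N a) sk.
have H3 : `|N a - N k ^+ 2| <= f' by rewrite ler_norml; lra.
have H4 : N (rc (N a) *: 1 + k * k) <= N (rc (N a) *: 1 + a) + f'.
  have -> : rc (N a) *: 1 + k * k = rc (N a) *: 1 + a - (a - k * k) by lmod E.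
  by apply: le_trans (N_B _ _) _; rewrite lerD.
by rewrite /r in H1 *; lra.
Qed.

(* The powers of [t - c^* c] and [t - c c^*] are intertwined by [c], so they
   grow at the same rate. *)
Lemma N_scalar_sub_swap c t T : 0 <= t <= T -> 0 < T ->
  N (rc t *: 1 - c * st c) <= T -> N (rc t *: 1 - st c * c) <= T.
Proof.
move=> /andP[t0 tT] T0; set f := _ - c * st c; set e := _ - st c * c => fT.
have se : st e = e by rewrite /e stB stZr st1 stM stK.
have comm n : e ^+ n * st c = st c * f ^+ n.
  elim: n => [|n IH]; first by rewrite !expr0 mul1r mulr1.
  rewrite !exprSr -[LHS]mulrA.
  have -> : e * st c = st c * f.
    by rewrite /e /f mulrBl mulrBr -scalerAl -scalerAr mul1r mulr1 mulrA.
  by rewrite [LHS]mulrA IH mulrA.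
pose D := N c ^+ 2 / T.
have D0 : 0 <= D by rewrite divr_ge0 ?sqr_ge0 ?ltW.
have Tn n : 0 <= T ^+ n by rewrite exprn_ge0 ?ltW.
(* Each further power contributes one term [st c * f ^+ n * c], of seminorm at most
   [T ^+ n * N c ^+ 2]; the growth relative to [T ^+ n] is thus linear. *)
have grow n : N (e ^+ n) <= T ^+ n * (1 + n%:R * D).
  elim: n => [|n IH]; first by rewrite !expr0 mul0r addr0 mul1r.
  have -> : e ^+ n.+1 = rc t *: e ^+ n - st c * f ^+ n * c.
    by rewrite exprSr {2}/e mulrBr -scalerAr mulr1 mulrA comm.
  have H1 : N (rc t *: e ^+ n) <= T * (T ^+ n * (1 + n%:R * D)).
    by rewrite N_Zr // ler_pM.
  have H2 : N (st c * f ^+ n * c) <= T ^+ n * N c ^+ 2.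
    apply: le_trans (N_M _ _) _; rewrite expr2 mulrA ler_wpM2r //.
    apply: le_trans (N_M _ _) _; rewrite N_st mulrC ler_wpM2r //.
    by apply: le_trans (N_X _ _) _; rewrite lerXn2r ?nnegrE // ltW.
  apply: le_trans (N_B _ _) _; apply: le_trans (lerD H1 H2) _.
  have -> : N c ^+ 2 = T * D by rewrite /D mulrC divfK ?gt_eqF.
  by rewrite exprS -natr1; move: (T ^+ n) (n%:R) => u v; lra.
(* As [e] is self-adjoint, [N] is exactly multiplicative on its powers of exponent [2 ^ k], so
   linear growth forces the ratio below 1. *)
have : N e / T <= 1.
  apply: (expr_pow2_le1 D0) => k; rewrite expr_div_n -N_pow2 //.
  by rewrite ler_pdivrMr ?exprn_gt0 // mulrC.
by rewrite ler_pdivrMr // mul1r.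
Qed.

(* Kaplansky's argument, with [p] in the role of [|h|], [x] in that of twice
   the negative part of [h], and [l] in that of the square root of [p]. *)
Lemma cpos_star_mul_le1 b : N b <= 1 -> cpos (st b * b).
Proof.
move=> b1; have [h hE] : exists h, h = st b * b by exists (st b * b).
have sh : st h = h by rewrite hE stM stK.
have h1 : N h <= 1 by rewrite hE N_star2 expr_le1.
rewrite -hE; split=> // e0 e0_gt.
(* The first bound serves the last triangle inequality; the second absorbs the factor [171 * 3] in
   the estimate of [N x ^+ 4]. *)
pose e := Num.min (e0 / 2) ((e0 / 2) ^+ 4 / 1000).
have e20 : 0 < e0 / 2 by rewrite divr_gt0.
have e_gt : 0 < e by rewrite lt_min e20 divr_gt0 ?exprn_gt0.
have e_le1 : e <= e0 / 2 by rewrite ge_min lexx.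
have e_le2 : 1000 * e <= (e0 / 2) ^+ 4.
  by rewrite mulrC -ler_pdivlMr // ge_min lexx orbT.
have sm : st (1 - h * h) = 1 - h * h by rewrite stB st1 stM sh.
(* [1 - y] approximates the root of [h h] and [1 - y2] the root of [1 - y]; they are renamed [p] and
   [l] below, and commute with [h] and with each other. *)
have [y [sy y1 yE yC]] := approx_sqrt sm (N_1subsq_le1 sh h1) e_gt.
have hy : GRing.comm h y.
  by apply: yC; apply: commrB; [exact: commr1|exact: commrM].
have [y2 [sy2 y21 y2E y2C]] := approx_sqrt sy y1 e_gt.
have hy2 : GRing.comm h y2 by exact: y2C.
have yy2 : GRing.comm y y2 by exact: y2C.
have Np : N (1 - y) <= 1 + 1 by apply: le_trans (N_B _ _) _; rewrite lerD.
have sp : st (1 - y) = 1 - y by rewrite stB st1 sy.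
have sl : st (1 - y2) = 1 - y2 by rewrite stB st1 sy2.
have hp : GRing.comm h (1 - y) by apply: commrB => //; exact: commr1.
have hl : GRing.comm h (1 - y2) by apply: commrB => //; exact: commr1.
have lp : GRing.comm (1 - y2) (1 - y).
  apply: commrB; first exact: commr1.
  by apply/commr_sym/commrB => //; exact: commr1.
move: y2E yE Np sp sl hp hl lp; rewrite subKr.
move: (1 - y) (1 - y2) => p l lE pE Np sp sl hp hl lp.
have [x xE] : exists x, x = p - h by exists (p - h).
have sx : st x = x by rewrite xE stB sp sh.
have Nx : N x <= 3 by rewrite xE; apply: le_trans (N_B _ _) _; lra.
have lx : l * x = x * l by rewrite xE mulrBr mulrBl lp hl.
have hx : h * x = x * h by rewrite xE mulrBr mulrBl hp.
(* Here [st c * c = x h x] is nearly [- (w w)]: [l l] is close to [p], and [(p + h) x = p p - h h]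
   is close to 0. So [st c * c] is nearly negative. *)
pose w := l * x; pose c := b * x.
have sw : st w = w by rewrite /w stM sx sl lx.
have scc : st c * c = x * h * x by rewrite /c stM sx hE !mulrA.
have dE : w * w + st c * c = (l * l - p) * x * x + (p * p - h * h) * x.
  rewrite scc /w; have -> : l * x * (l * x) = l * l * x * x.
    by rewrite mulrA -[l * x * l]mulrA -lx mulrA.
  have -> : (p * p - h * h) * x = p * x * x + x * h * x.
    by rewrite {2 4}xE -!mulrDl; congr (_ * x); ncring E.
  by rewrite mulrBl mulrBl addrA subrK.
have Nd : N (w * w + st c * c) <= 12 * e.
  rewrite dE; apply: le_trans (N_D _ _) _.
  have H1 : N ((l * l - p) * x * x) <= e * 3 * 3.
    apply: le_trans (N_M _ _) _; rewrite ler_pM //.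
    by apply: le_trans (N_M _ _) _; rewrite ler_pM.
  have H2 : N ((p * p - h * h) * x) <= e * 3.
    by apply: le_trans (N_M _ _) _; rewrite ler_pM.
  by lra.
move: Nd; set d := w * w + st c * c => Nd.
set t := N c ^+ 2.
have Ncc : N (st c * c) = t by rewrite N_star2.
have Ncc' : N (c * st c) = t by rewrite -{1}[c]stK N_star2 N_st.
(* Real and imaginary parts of [c], up to sign: [c * st c + st c * c = 2 u u + 2 v v]. As [st c * c]
   is nearly [- (w w)], the other product [c * st c] is nearly the positive [g]. *)
pose u := rc (2^-1 : R) *: (c + st c).
pose v := rc (2^-1 : R) *: ('i%C *: (c - st c)).
have su : st u = u by rewrite /u stZr stD stK addrC.
have sv : st v = v.
  by rewrite /v stZr stZ stB stK conjc_i scaleNr -scalerN opprB.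
pose g := rc (2 : R) *: (u * u) + rc (2 : R) *: (v * v) + w * w.
have ccE : c * st c = g - d.
  rewrite /g /d /u /v; move: (w * w) => ww.
  by move: (c) (st c) => c1 c2; ncring E.
have pg : cpos g.
  apply: cposD; last exact: cpos_sq.
  by apply: cposD; apply: cposZ => //; apply: cpos_sq.
have t0 : 0 <= t by exact: sqr_ge0.
have Ng : N g <= t + 12 * e.
  have -> : g = c * st c + d by rewrite ccE subrK.
  by apply: le_trans (N_D _ _) _; rewrite Ncc' lerD2l.
have H1 : N (rc (t + 12 * e) *: 1 - c * st c) <= t + 24 * e.
  have -> : rc (t + 12 * e) *: 1 - c * st c = (rc (t + 12 * e) *: 1 - g) + d.
    by rewrite ccE opprB addrA [RHS]addrAC.
  apply: le_trans (N_D _ _) _; have := cpos_contr pg Ng; lra.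
have H2 : N (rc (t + 12 * e) *: 1 - st c * c) <= t + 24 * e.
  by apply: N_scalar_sub_swap H1; [apply/andP; split|]; lra.
have H3 : N (rc (t + 12 * e) *: 1 + w * w) <= t + 36 * e.
  have -> : rc (t + 12 * e) *: 1 + w * w = (rc (t + 12 * e) *: 1 - st c * c) + d.
    by rewrite /d; move: (w * w) (st c * c) => z1 z2; lmod E.
  apply: le_trans (N_D _ _) _; lra.
have Nw1 : N w ^+ 2 <= t + 12 * e.
  rewrite -N_sq //; have -> : w * w = d - st c * c by rewrite /d addrK.
  by apply: le_trans (N_B _ _) _; rewrite Ncc addrC lerD2l.
have Nw2 : t <= N w ^+ 2 + 12 * e.
  rewrite -N_sq // -Ncc; have -> : st c * c = d - w * w by rewrite /d addrC addKr.
  by apply: le_trans (N_B _ _) _; rewrite addrC lerD2l.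
(* [H3] bounds [t + w w] by about [t], while [N w ^+ 2] is about [t], which makes the same seminorm
   at least about [2 t]. *)
have t_le : t <= 84 * e.
  have := N_scalar_pos_ge (t + 12 * e) sw.
  have : `|t + 12 * e - N w ^+ 2| <= 24 * e by rewrite ler_norml; lra.
  by lra.
(* Since [x = (p + h) - 2 h], the cube of [x] is [(p p - h h) x - 2 x h x], and both terms are now
   small. *)
have Nx3 : N (x * x * x) <= 171 * e.
  have -> : x * x * x = (p * p - h * h) * x - rc (2 : R) *: (x * h * x).
    rewrite scalerAl -mulrBl; congr (_ * x).
    have phE : p * p - h * h = (p + h) * x by rewrite xE mulrDl !mulrBr hp; lmod E.
    rewrite phE -hx scalerAl -mulrBl; congr (_ * x).
    by rewrite xE; lmod E.
  rewrite -scc; apply: le_trans (N_B _ _) _; rewrite N_Zr // Ncc.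
  have : N ((p * p - h * h) * x) <= e * 3.
    by apply: le_trans (N_M _ _) _; rewrite ler_pM.
  by lra.
have Nx4 : N x ^+ 4 <= (e0 / 2) ^+ 4.
  rewrite (exprM _ 2 2) -N_sq // -N_sq ?stM ?sx // mulrA.
  apply: le_trans (N_M _ _) _.
  apply: le_trans (_ : 171 * e * 3 <= _); first by rewrite ler_pM.
  by lra.
exists l; split=> //.
have -> : h - l * l = - x - (l * l - p) by rewrite xE; move: (l * l) => z; lmod E.
apply: le_trans (N_B _ _) _; rewrite N_N.
have : N x <= e0 / 2 by rewrite -(@ler_pXn2r _ 4) ?nnegrE // ltW.
by lra.
Qed.

Lemma cpos_star_mul b : cpos (st b * b).
Proof.
pose r := N b + 1; have r0 : 0 < r by rewrite ltr_wpDl.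
have -> : st b * b = rc (r ^+ 2) *: (st (rc r^-1 *: b) * (rc r^-1 *: b)).
  rewrite stZr -scalerAl -scalerAr !scalerA -!rmorphM.
  by rewrite -mulrA -expr2 exprVn divff ?scale1r // expf_neq0 // gt_eqF.
apply: cposZ; first exact: sqr_ge0.
apply: cpos_star_mul_le1; rewrite N_Zr ?invr_ge0 ?(ltW r0) //.
by rewrite mulrC ler_pdivrMr // mul1r lerDl.
Qed.

End CStarSeminorm.

(** * The unitization and its operator seminorm *)

Section Unitization.
Variables (R : realType) (A : lmodType R[i]).
Variables (mul : A -> A -> A) (star : A -> A).
Hypothesis HA : is_star_algebra mul star.

Lemma amulA a b c : mul a (mul b c) = mul (mul a b) c.
Proof. by have [[h _ _ _ _] _] := HA; exact: h. Qed.
Lemma amulDl a b c : mul (a + b) c = mul a c + mul b c.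
Proof. by have [[_ h _ _ _] _] := HA; exact: h. Qed.
Lemma amulDr a b c : mul a (b + c) = mul a b + mul a c.
Proof. by have [[_ _ h _ _] _] := HA; exact: h. Qed.
Lemma amulZl k a b : mul (k *: a) b = k *: mul a b.
Proof. by have [[_ _ _ h _] _] := HA; exact: h. Qed.
Lemma amulZr k a b : mul a (k *: b) = k *: mul a b.
Proof. by have [[_ _ _ _ h] _] := HA; exact: h. Qed.
Lemma astarK a : star (star a) = a.
Proof. by have [_ [h _ _ _]] := HA; exact: h. Qed.
Lemma astarD a b : star (a + b) = star a + star b.
Proof. by have [_ [_ h _ _]] := HA; exact: h. Qed.
Lemma astarZ k a : star (k *: a) = conjc k *: star a.
Proof. by have [_ [_ _ h _]] := HA; exact: h. Qed.
Lemma astarM a b : star (mul a b) = mul (star b) (star a).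
Proof. by have [_ [_ _ _ h]] := HA; exact: h. Qed.
Lemma amul0l b : mul 0 b = 0.
Proof. by rewrite -(scale0r (0 : A)) amulZl !scale0r. Qed.
Lemma amul0r b : mul b 0 = 0.
Proof. by rewrite -(scale0r (0 : A)) amulZr !scale0r. Qed.
(** The proof argument is a phantom: it lets the ring and algebra structures, whose laws rest on it,
    be attached to the type. *)
Definition unitization of is_star_algebra mul star : Type := (R[i]^o * A)%type.
Local Notation U := (unitization HA).
HB.instance Definition _ := GRing.Lmodule.copy U (R[i]^o * A)%type.

Definition unit_mul (x y : U) : U :=
  (x.1 * y.1, x.1 *: y.2 + y.1 *: x.2 + mul x.2 y.2).
Definition unit_one : U := (1, 0).
Definition unit_star (x : U) : U := (conjc x.1, star x.2).
Definition unit_act (x : U) (b : A) : A := x.1 *: b + mul x.2 b.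

Lemma unit_mulA : associative unit_mul.
Proof.
move=> [x1 x2] [y1 y2] [z1 z2]; congr (_, _) => /=; first by rewrite mulrA.
rewrite !(amulDl, amulDr, amulZl, amulZr, amulA, scalerDr, scalerA).
lmod A.
Qed.

Lemma unit_mul1l : left_id unit_one unit_mul.
Proof. by case=> x1 x2; rewrite /unit_mul /= mul1r scale1r scaler0 amul0l !addr0. Qed.

Lemma unit_mul1r : right_id unit_one unit_mul.
Proof. by case=> x1 x2; rewrite /unit_mul /= mulr1 scale1r scaler0 amul0r add0r addr0. Qed.

Lemma unit_mulDl : left_distributive unit_mul +%R.
Proof.
move=> [x1 x2] [y1 y2] [z1 z2]; congr (_, _) => /=; first by rewrite mulrDl.
by rewrite amulDl scalerDl scalerDr; lmod A.
Qed.

Lemma unit_mulDr : right_distributive unit_mul +%R.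
Proof.
move=> [x1 x2] [y1 y2] [z1 z2]; congr (_, _) => /=; first by rewrite mulrDr.
by rewrite amulDr scalerDl scalerDr; lmod A.
Qed.

Lemma unit_one_neq0 : unit_one != 0 :> U.
Proof. by apply/eqP => -[] /eqP; rewrite oner_eq0. Qed.

HB.instance Definition _ := GRing.Zmodule_isNzRing.Build U
  unit_mulA unit_mul1l unit_mul1r unit_mulDl unit_mulDr unit_one_neq0.

Lemma unit_scalerAl (k : R[i]) (x y : U) : k *: (x * y) = k *: x * y.
Proof.
case: x y => [x1 x2] [y1 y2]; congr (_, _) => /=; first by rewrite scalerAl.
by rewrite amulZl !scalerDr !scalerA ![y1 * _]mulrC.
Qed.

HB.instance Definition _ := GRing.Lmodule_isLalgebra.Build R[i] U unit_scalerAl.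

Lemma unit_scalerAr (k : R[i]) (x y : U) : k *: (x * y) = x * (k *: y).
Proof.
case: x y => [x1 x2] [y1 y2]; congr (_, _) => /=; first by rewrite scalerAr.
by rewrite amulZr !scalerDr !scalerA ![x1 * k]mulrC.
Qed.

HB.instance Definition _ := GRing.Lalgebra_isAlgebra.Build R[i] U unit_scalerAr.

Lemma unit_star_algebra : is_star_algebra (A := U) *%R unit_star.
Proof.
split; split.
- exact: mulrA.
- exact: mulrDl.
- exact: mulrDr.
- by move=> k a b; rewrite -scalerAl.
- by move=> k a b; rewrite -scalerAr.
- by case=> a1 a2; rewrite /unit_star /= conjcK astarK.
- by case=> a1 a2 [b1 b2]; congr (_, _) => /=; [rewrite rmorphD|rewrite astarD].
- by move=> k [a1 a2]; congr (_, _) => /=; [rewrite rmorphM|rewrite astarZ].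
- move=> [a1 a2] [b1 b2]; congr (_, _) => /=; first by rewrite rmorphM mulrC.
  by rewrite !astarD !astarZ astarM [X in X + _]addrC.
Qed.

Lemma unit_actM x y b : unit_act (x * y) b = unit_act x (unit_act y b).
Proof.
case: x y => [x1 x2] [y1 y2]; rewrite /unit_act /=.
rewrite !(amulDl, amulDr, amulZl, amulZr, amulA, scalerDr, scalerA) -!addrA.
by congr (_ + _); rewrite addrCA.
Qed.

Lemma unit_actD x y b : unit_act (x + y) b = unit_act x b + unit_act y b.
Proof. by rewrite /unit_act /= scalerDl amulDl addrACA. Qed.

Lemma unit_actZ k x b : unit_act (k *: x) b = k *: unit_act x b.
Proof. by rewrite /unit_act /= amulZl scalerDr scalerA. Qed.

Lemma unit_act0 x : unit_act x 0 = 0.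
Proof. by rewrite /unit_act scaler0 amul0r addr0. Qed.

Lemma unit_actZr k x b : unit_act x (k *: b) = k *: unit_act x b.
Proof. by rewrite /unit_act amulZr scalerDr !scalerA mulrC. Qed.

Lemma unit_act_star x b c :
  mul (star (unit_act x b)) c = mul (star b) (unit_act (unit_star x) c).
Proof.
by rewrite /unit_act astarD astarZ astarM amulDl amulDr amulZl amulZr -amulA.
Qed.

Variable q : A -> R.
Hypothesis qP : is_cstar_seminorm mul star q.

(** The operator seminorm of left multiplication on [A], chosen because it inherits the
    C*-identity. *)
Definition unit_norm (x : U) : R :=
  sup (fun r => exists b, q b <= 1 /\ r = q (unit_act x b)).

Lemma unit_act_bound x b : q (unit_act x b) <= (normC x.1 + q x.2) * q b.
Proof.
apply: le_trans (cs_D qP _ _) _; rewrite (cs_Z qP) mulrDl lerD2l.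
exact: cs_M qP _ _.
Qed.

Lemma normC_ge0 (k : R[i]) : 0 <= normC k.
Proof. by case: k => a b; exact: sqrtr_ge0. Qed.

Lemma unit_norm_has_sup x :
  has_sup (fun r => exists b, q b <= 1 /\ r = q (unit_act x b)).
Proof.
split; first by exists (q (unit_act x 0)), 0; rewrite (cs_0 qP).
exists (normC x.1 + q x.2) => r [b [b1 ->]].
apply: le_trans (unit_act_bound _ _) _.
by rewrite -[leRHS]mulr1 ler_wpM2l // addr_ge0 ?normC_ge0 ?(cs_ge0 qP).
Qed.

Lemma unit_norm_ge0 x : 0 <= unit_norm x.
Proof.
apply: (sup_upper_bound (unit_norm_has_sup x)).
by exists 0; rewrite unit_act0 (cs_0 qP).
Qed.

Lemma unit_norm_act x b : q (unit_act x b) <= unit_norm x * q b.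
Proof.
(* Such a [b] cannot be normalised; the crude bound already makes the left side vanish. *)
have [b0|b0] := eqVneq (q b) 0.
  by have := unit_act_bound x b; rewrite b0 !mulr0.
have qb : 0 < q b by rewrite lt_def b0 (cs_ge0 qP).
rewrite -ler_pdivrMr // mulrC.
rewrite -(cs_Zr_ge0 qP) ?invr_ge0 ?(ltW qb) // -unit_actZr.
apply: (sup_upper_bound (unit_norm_has_sup x)); exists (rc (q b)^-1 *: b).
by rewrite (cs_Zr_ge0 qP) ?invr_ge0 ?(ltW qb) // mulVf.
Qed.

Lemma unit_norm_le x M : 0 <= M -> (forall b, q (unit_act x b) <= M * q b) ->
  unit_norm x <= M.
Proof.
move=> M0 H; apply: sup_le_ub; first by case: (unit_norm_has_sup x).
move=> r [b [b1 ->]]; apply: le_trans (H b) _.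
by rewrite -[leRHS]mulr1 ler_wpM2l.
Qed.

Lemma unit_normZ k x : unit_norm (k *: x) = normC k * unit_norm x.
Proof.
have le k' y : unit_norm (k' *: y) <= normC k' * unit_norm y.
  apply: unit_norm_le => [|b]; first by rewrite mulr_ge0 ?normC_ge0 ?unit_norm_ge0.
  by rewrite unit_actZ (cs_Z qP) -mulrA ler_wpM2l ?normC_ge0 ?unit_norm_act.
apply/le_anti; rewrite le /=.
have [->|k0] := eqVneq k 0.
  by rewrite /normC ComplexField.Normc.normc0 mul0r unit_norm_ge0.
have nk : 0 < normC k.
  rewrite lt_def normC_ge0 andbT; apply: contra k0 => /eqP.
  by move/ComplexField.Normc.eq0_normc/eqP.
rewrite mulrC -ler_pdivlMr // mulrC.
have := le k^-1 (k *: x); rewrite scalerA mulVf // scale1r.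
by rewrite {1}/normC ComplexField.Normc.normcV.
Qed.

(** The C*-identity of [q] at [x b] turns [q (x b) ^+ 2] into the seminorm of [star b] times
    [(unit_star x * x) b]. *)
Lemma unit_norm_sq_le x : unit_norm x ^+ 2 <= unit_norm (unit_star x * x).
Proof.
set M := unit_norm (_ * _); have M0 : 0 <= M by exact: unit_norm_ge0.
rewrite -(sqr_sqrtr M0) lerXn2r ?nnegrE ?unit_norm_ge0 ?sqrtr_ge0 //.
apply: unit_norm_le => [|b]; first exact: sqrtr_ge0.
have qb := cs_ge0 qP b.
rewrite -(@ler_pXn2r _ 2) ?nnegrE ?mulr_ge0 ?sqrtr_ge0 ?(cs_ge0 qP) //.
rewrite exprMn sqr_sqrtr // -(cs_star2 qP) unit_act_star -unit_actM.
apply: le_trans (cs_M qP _ _) _; rewrite (cs_star HA qP) expr2 mulrCA.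
by rewrite ler_wpM2l // unit_norm_act.
Qed.

Lemma unit_normM x y : unit_norm (x * y) <= unit_norm x * unit_norm y.
Proof.
apply: unit_norm_le => [|b]; first by rewrite mulr_ge0 ?unit_norm_ge0.
rewrite unit_actM; apply: le_trans (unit_norm_act _ _) _.
by rewrite -mulrA ler_wpM2l ?unit_norm_ge0 ?unit_norm_act.
Qed.

Lemma unit_norm_star_le x : unit_norm x <= unit_norm (unit_star x).
Proof.
have [->|x0] := eqVneq (unit_norm x) 0; first exact: unit_norm_ge0.
have x_gt : 0 < unit_norm x by rewrite lt_def x0 unit_norm_ge0.
rewrite -(ler_pM2r x_gt) -expr2.
exact: le_trans (unit_norm_sq_le x) (unit_normM _ _).
Qed.

Lemma unit_norm_cstar : is_cstar_seminorm (A := U) *%R unit_star unit_norm.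
Proof.
split.
- exact: unit_norm_ge0.
- move=> x y; apply: unit_norm_le => [|b]; first by rewrite addr_ge0 ?unit_norm_ge0.
  rewrite unit_actD mulrDl; apply: le_trans (cs_D qP _ _) _.
  by rewrite lerD ?unit_norm_act.
- exact: unit_normZ.
- exact: unit_normM.
- move=> x; apply/le_anti; rewrite unit_norm_sq_le andbT.
  apply: le_trans (unit_normM _ _) _; rewrite expr2 ler_wpM2r ?unit_norm_ge0 //.
  have := unit_norm_star_le (unit_star x).
  by have [_ [-> _ _ _]] := unit_star_algebra.
Qed.

Lemma unit_norm1 : unit_norm 1 <= 1.
Proof.
by apply: unit_norm_le => // b; rewrite /unit_act /= scale1r amul0l addr0 mul1r.
Qed.

(** The lower bound comes from testing left multiplication by [a] on [star a]. *)
Lemma unit_norm_embed a : unit_norm (0, a) = q a.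
Proof.
apply/le_anti/andP; split.
  apply: unit_norm_le => [|b]; first exact: cs_ge0 qP _.
  by rewrite /unit_act /= scale0r add0r; exact: cs_M qP _ _.
have [->|a0] := eqVneq (q a) 0; first exact: unit_norm_ge0.
have a_gt : 0 < q a by rewrite lt_def a0 (cs_ge0 qP).
rewrite -(ler_pM2r a_gt) -{3}(cs_star HA qP a).
apply: le_trans (unit_norm_act _ _); rewrite /unit_act /= scale0r add0r.
by rewrite -{3}(astarK a) (cs_star2 qP) (cs_star HA qP) expr2.
Qed.

End Unitization.

(** Pulls [cpos] back from the unitization. The abstract cone [P] is the only form in which
    positivity enters the module estimates. *)
Lemma cstar_positive_cone (R : realType) (A : lmodType R[i]) mul star q :
  is_star_algebra mul star -> is_cstar_seminorm (A := A) mul star q ->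
  exists P : A -> Prop,
    [/\ forall b, P (mul (star b) b),
        forall a b, P a -> P b -> P (a + b),
        forall r a, 0 <= r -> P a -> P (rc r *: a)
      & forall a d, P a -> P d -> q a <= q (a + d)].
Proof.
move=> HA qP; have sU := unit_star_algebra HA; have nU := unit_norm_cstar HA qP.
have n1 := unit_norm1 HA qP.
pose emb a : unitization HA := (0, a).
have embD a b : emb (a + b) = emb a + emb b.
  by congr (_, _) => /=; rewrite addr0.
have embZ k a : emb (k *: a) = k *: emb a.
  by congr (_, _) => /=; rewrite scaler0.
have embM a b : emb (mul a b) = emb a * emb b.
  by congr (_, _) => /=; rewrite ?mulr0 // !scale0r !add0r.
exists (fun a => cpos (@unit_star _ _ _ _ HA) (unit_norm q) (emb a)); split.
- move=> b; rewrite embM.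
  have -> : emb (star b) = unit_star (emb b) by congr (_, _); exact: esym (conjc0 R).
  exact: cpos_star_mul sU nU n1 _.
- by move=> a b pa pb; rewrite embD; apply: cposD sU nU n1 _ _ pa pb.
- by move=> r a r0 pa; rewrite embZ; apply: cposZ sU nU _ _ r0 pa.
- move=> a d pa pd; rewrite -!(unit_norm_embed HA qP) -/(emb _) -/(emb _) embD.
  exact: cpos_mono sU nU n1 _ _ pa pd.
Qed.

(** While [k y <= 1/2], the factor 2 absorbs the quadratic term of the induction step. *)
Lemma expr1D_le2 (R : realType) (y : R) m k : 0 <= y -> m%:R * y <= 2^-1 -> (k <= m)%N ->
  (1 + y) ^+ k <= 1 + 2 * (k%:R * y).
Proof.
move=> y0 my; elim: k => [|k IH] km; first by rewrite expr0 mul0r mulr0 addr0.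
rewrite exprS; have IH' := IH (ltnW km).
apply: le_trans (ler_wpM2l (_ : 0 <= 1 + y) IH') _; first lra.
have ky : k%:R * y <= 2^-1.
  by apply: le_trans my; rewrite ler_wpM2r // ler_nat ltnW.
rewrite -natr1; have := ler_wpM2r y0 ky; lra.
Qed.

(** * Inequalities for algebra-valued inner products *)

Section InnerProduct.
Variables (R : realType) (A X : lmodType R[i]).
Variables (mul : A -> A -> A) (star : A -> A) (q : A -> R) (ip : X -> X -> A).
Hypothesis HA : is_star_algebra mul star.
Hypothesis qP : is_cstar_seminorm mul star q.
Hypothesis ipDl : forall x y z, ip (x + y) z = ip x z + ip y z.
Hypothesis ipZl : forall (k : R[i]) x y, ip (k *: x) y = k *: ip x y.
Hypothesis ipC : forall x y, star (ip x y) = ip y x.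
Variable P : A -> Prop.
Hypothesis P_ip : forall x, P (ip x x).
Hypothesis P_D : forall a b, P a -> P b -> P (a + b).
Hypothesis P_Z : forall r a, 0 <= r -> P a -> P (rc r *: a).
Hypothesis P_mono : forall a d, P a -> P d -> q a <= q (a + d).

Let nq := qX ip q.

Lemma ipDr x y z : ip x (y + z) = ip x y + ip x z.
Proof. by rewrite -ipC ipDl (astarD HA) !ipC. Qed.

Lemma ipZr k x y : ip x (k *: y) = conjc k *: ip x y.
Proof. by rewrite -ipC ipZl (astarZ HA) ipC. Qed.

Lemma ipZr_real r x y : ip x (rc r *: y) = rc r *: ip x y.
Proof. by rewrite ipZr conjc_real. Qed.

Lemma ipNl x y : ip (- x) y = - ip x y.
Proof. by rewrite -scaleN1r ipZl scaleN1r. Qed.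

Lemma ipNr x y : ip x (- y) = - ip x y.
Proof. by rewrite -scaleN1r ipZr rmorphN1 scaleN1r. Qed.

Lemma ip0r x : ip x 0 = 0.
Proof. by rewrite -(scale0r (0 : X)) ipZr conjc0 scale0r. Qed.

Lemma ip0l x : ip 0 x = 0.
Proof. by rewrite -(scale0r (0 : X)) ipZl scale0r. Qed.

Lemma ip_sumr x n (v : nat -> X) :
  ip x (\sum_(k < n) v k) = \sum_(k < n) ip x (v k).
Proof. by elim: n => [|n IH]; rewrite ?big_ord0 ?ip0r // !big_ord_recr ipDr IH. Qed.

Lemma P_0 : P 0.
Proof. by rewrite -(ip0l 0); exact: P_ip. Qed.

Lemma P_sum n (a : nat -> A) : (forall k, P (a k)) -> P (\sum_(k < n) a k).
Proof.
move=> Pa; elim: n => [|n IH]; first by rewrite big_ord0; exact: P_0.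
by rewrite big_ord_recr; exact: P_D.
Qed.

Lemma P_mono_sub a b : P a -> P (b - a) -> q a <= q b.
Proof. by move=> Pa Pba; rewrite -[b](subrK a) addrC; exact: P_mono. Qed.

Lemma nq_ge0 x : 0 <= nq x. Proof. exact: sqrtr_ge0. Qed.

Lemma nq_sq x : nq x ^+ 2 = q (ip x x).
Proof. by rewrite sqr_sqrtr // (cs_ge0 qP). Qed.

Lemma nqZ r x : 0 <= r -> nq (rc r *: x) = r * nq x.
Proof.
move=> r0; rewrite /nq /qX ipZl ipZr_real scalerA -rmorphM (cs_Zr_ge0 qP) ?mulr_ge0 //.
by rewrite sqrtrM ?mulr_ge0 // -expr2 sqrtr_sqr ger0_norm.
Qed.

(** The parallelogram law, after adding the positive [ip (x - y) (x - y)] by monotonicity. *)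
Lemma q_ip_add x y :
  q (ip (x + y) (x + y)) <= 2 * (q (ip x x) + q (ip y y)).
Proof.
apply: le_trans (P_mono (P_ip _) (P_ip (x - y))) _.
have -> : ip (x + y) (x + y) + ip (x - y) (x - y) =
  rc (2 : R) *: (ip x x + ip y y).
  by rewrite !(ipDl, ipDr, ipNl, ipNr); lmod A.
by rewrite (cs_Zr_ge0 qP) // ler_pM2l //; exact: cs_D qP _ _.
Qed.

(** Polarization: four times [ip x y] is a combination of four values [ip (x + k y) (x + k y)] with
    [k] a fourth root of unity, each bounded by [q_ip_add]. *)
Lemma q_ip_le_add x y : q (ip x y) <= 2 * (q (ip x x) + q (ip y y)).
Proof.
have bound k : conjc k * k = 1 ->
    q (ip (x + k *: y) (x + k *: y)) <= 2 * (q (ip x x) + q (ip y y)).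
  move=> kk; apply: le_trans (q_ip_add _ _) _.
  by rewrite ipZl ipZr scalerA [k * _]mulrC kk scale1r.
have B1 : q (ip (x + y) (x + y)) <= 2 * (q (ip x x) + q (ip y y)) := q_ip_add x y.
have B2 := bound (-1); rewrite rmorphN1 mulrNN mulr1 in B2.
have B3 := bound 'i%C; rewrite conjc_i in B3.
have conjcNi : conjc (- 'i%C : R[i]) = 'i%C by complex_eq.
have B4 := bound (- 'i%C); rewrite conjcNi in B4.
have i2 : - 'i%C * 'i%C = 1 :> R[i] by complex_eq.
have i2' : 'i%C * - 'i%C = 1 :> R[i] by complex_eq.
move: (B2 erefl) (B3 i2) (B4 i2') => {}B2 {}B3 {}B4.
have H : rc (4 : R) *: ip x y =
    ip (x + y) (x + y) - ip (x + -1 *: y) (x + -1 *: y) +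
    'i%C *: (ip (x + 'i%C *: y) (x + 'i%C *: y) -
             ip (x + - 'i%C *: y) (x + - 'i%C *: y)).
  rewrite !(ipDl, ipDr, ipZl, ipZr) conjcNi conjc_i rmorphN1.
  by lmod A.
have HH := cs_Zr_ge0 qP (ip x y) (ler0n R 4); rewrite H in HH.
have := cs_D qP (ip (x + y) (x + y) - ip (x + -1 *: y) (x + -1 *: y))
  ('i%C *: (ip (x + 'i%C *: y) (x + 'i%C *: y) -
             ip (x + - 'i%C *: y) (x + - 'i%C *: y))).
rewrite HH (cs_Zi qP).
have := cs_B qP (ip (x + y) (x + y)) (ip (x + -1 *: y) (x + -1 *: y)).
have := cs_B qP (ip (x + 'i%C *: y) (x + 'i%C *: y))
             (ip (x + - 'i%C *: y) (x + - 'i%C *: y)).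
by lra.
Qed.

(* Cauchy-Schwarz up to the constant 4, which is all the theorem needs: scale
   [x] and [y] oppositely in [q_ip_le_add] and optimise. *)
Lemma q_ip_le x y : q (ip x y) <= 4 * (nq x * nq y).
Proof.
apply/ler_addgt0Pr => e0 e0_gt.
(* Shifting both seminorms by [e] keeps the scaling [s] finite and nonzero; the cost
   [2 e (nq x + nq y)] is below [D e = e0]. *)
pose D := 2 * (nq x + nq y) + 1.
have [x0 y0] := (nq_ge0 x, nq_ge0 y).
have D0 : 0 < D by rewrite /D; lra.
pose e := e0 / D; have e_gt : 0 < e by rewrite divr_gt0.
have De : D * e = e0 by rewrite /e mulrC divfK ?gt_eqF.
have xe : 0 < nq x + e by rewrite ltr_wpDl.
have ye : 0 < nq y + e by rewrite ltr_wpDl.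
pose s := Num.sqrt ((nq y + e) / (nq x + e)).
have s_gt : 0 < s by rewrite sqrtr_gt0 divr_gt0.
have ss : s ^+ 2 = (nq y + e) / (nq x + e) by rewrite sqr_sqrtr // divr_ge0 ?ltW.
have -> : ip x y = ip (rc s *: x) (rc s^-1 *: y).
  by rewrite ipZl ipZr_real scalerA -rmorphM divff ?gt_eqF // scale1r.
apply: le_trans (q_ip_le_add _ _) _.
rewrite -!nq_sq !nqZ ?invr_ge0 ?ltW // !exprMn exprVn ss invf_div.
have H1 : (nq y + e) / (nq x + e) * nq x ^+ 2 <= (nq y + e) * nq x.
  rewrite mulrAC ler_pdivrMr // -mulrA ler_pM2l // expr2 ler_wpM2l //; lra.
have H2 : (nq x + e) / (nq y + e) * nq y ^+ 2 <= (nq x + e) * nq y.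
  rewrite mulrAC ler_pdivrMr // -mulrA ler_pM2l // expr2 ler_wpM2l //; lra.
by move: De; rewrite /D; lra.
Qed.

Lemma sum_ip_sub n (v : nat -> X) z :
  \sum_(k < n) ip (v k - z) (v k - z) =
  \sum_(k < n) ip (v k) (v k) - ip (\sum_(k < n) v k) z
    - ip z (\sum_(k < n) v k) + rc (n%:R : R) *: ip z z.
Proof.
elim: n => [|n IH]; first by rewrite !big_ord0 ip0l ip0r !subr0 add0r scale0r.
rewrite !big_ord_recr IH !(ipDl, ipDr, ipNl, ipNr) -natr1.
move: (\sum_(i < n) _) => a; move: (\sum_(i < n) _) => b.
by rewrite /=; move: (n%:R) => r; lmod A.
Qed.

(** From [n] to [n + 1], the gap between the two sides, taken in [A], grows by the sum of the
    positive [ip (v k - v n) (v k - v n)]. *)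
Lemma jensen n (v : nat -> X) :
  nq (\sum_(k < n) v k) ^+ 2 <= n%:R * q (\sum_(k < n) ip (v k) (v k)).
Proof.
rewrite nq_sq -(cs_Zr_ge0 qP) ?ler0n //; apply: P_mono_sub; first exact: P_ip.
elim: n => [|n IH]; first by rewrite !big_ord0 ip0l scaler0 subr0; exact: P_0.
have := P_D IH (P_sum n (fun k => P_ip (v k - v n))); rewrite sum_ip_sub.
rewrite !big_ord_recr !(ipDl, ipDr) -natr1 /=.
move: (\sum_(i < n) _) => a; move: (\sum_(i < n) _) => b.
set u := (X in P X -> _); set w := (X in _ -> P X); suff -> : w = u by [].
by rewrite /u /w; move: (n%:R) => r; lmod A.
Qed.

(** Even indices arise because moving [k] self-adjoint steps across [ip (u k) (u k)] produces
    [u (2 k)]. *)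
Lemma sum_even_le n (a : nat -> A) : (forall k, P (a k)) ->
  P (\sum_(k < n.*2) a k - \sum_(k < n) a k.*2).
Proof.
move=> Pa; elim: n => [|n IH]; first by rewrite !big_ord0 subr0; exact: P_0.
rewrite doubleS !big_ord_recr /=; have := P_D IH (Pa n.*2.+1).
move: (\sum_(k < n) _) (\sum_(k < n.*2) _) => z w.
by have -> : w - z + a n.*2.+1 = w + a n.*2 + a n.*2.+1 - (z + a n.*2) by lmod A.
Qed.

(** * Approximating the range of [K] by the range of [T] *)

Section Adjoint.
Variables (T Ts : X -> X) (c : R).
Hypothesis TD : forall x y, T (x + y) = T x + T y.
Hypothesis TZ : forall (k : R[i]) x, T (k *: x) = k *: T x.
Hypothesis TP : is_adjoint ip T Ts.
Hypothesis c_gt0 : 0 < c.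
Hypothesis Tc : forall x, nq (T x) <= c * nq x.

Lemma adjoint_sym x y : ip x (T y) = ip (Ts x) y.
Proof. by rewrite -ipC TP ipC. Qed.

(** The square of the left side is [q (ip (T (Ts x)) x)]; the 4 is the Cauchy-Schwarz constant of
    [q_ip_le]. *)
Lemma adjoint_bound x : nq (Ts x) <= 4 * c * nq x.
Proof.
have [t0|t0] := eqVneq (nq (Ts x)) 0.
  by rewrite t0 !mulr_ge0 ?nq_ge0 ?ltW.
have t_gt : 0 < nq (Ts x) by rewrite lt_def t0 nq_ge0.
rewrite -(ler_pM2r t_gt) -expr2 nq_sq -TP.
apply: le_trans (q_ip_le _ _) _; rewrite -!mulrA ler_pM2l //.
have -> : c * (nq x * nq (Ts x)) = c * nq (Ts x) * nq x by ring.
by rewrite ler_wpM2r ?nq_ge0.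
Qed.

Let M := (4 * c ^+ 2) ^+ 2.

Lemma TTs_bound v : q (ip (T (Ts v)) (T (Ts v))) <= M * q (ip v v).
Proof.
have c2 : 0 <= 4 * c ^+ 2 by rewrite mulr_ge0 ?sqr_ge0.
rewrite -!nq_sq -exprMn lerXn2r ?nnegrE ?nq_ge0 // ?(mulr_ge0 c2) ?nq_ge0 //.
apply: le_trans (Tc _) _; have -> : 4 * c ^+ 2 * nq v = c * (4 * c * nq v) by ring.
by rewrite ler_pM2l // adjoint_bound.
Qed.

Variables (K Ks : X -> X) (Alo Bup : R).
Hypothesis KP : is_adjoint ip K Ks.
Hypothesis Alo_gt0 : 0 < Alo.
Hypothesis Bup_gt0 : 0 < Bup.
Hypothesis KT : forall v, P (rc Bup *: ip (Ts v) (Ts v) - rc Alo *: ip (Ks v) (Ks v)).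

(** * Gradient descent for the distance to the range of T *)

Section Descent.
Variable s : R.
Hypothesis s_gt0 : 0 < s.

Definition descent (v : X) : X := v - rc s *: T (Ts v).

Lemma ip_descent v :
  ip (descent v) (descent v) + rc (2 * s) *: ip (Ts v) (Ts v) =
  ip v v + rc (s ^+ 2) *: ip (T (Ts v)) (T (Ts v)).
Proof.
rewrite /descent !(ipDl, ipDr, ipNl, ipNr, ipZl, ipZr_real).
have -> : ip v (T (Ts v)) = ip (Ts v) (Ts v) by rewrite adjoint_sym.
have -> : ip (T (Ts v)) v = ip (Ts v) (Ts v) by rewrite TP.
by lmod A.
Qed.

Lemma descent_sym m v w : ip (iter m descent v) w = ip v (iter m descent w).
Proof.
elim: m v w => [//|m IH] v w; rewrite iterSr IH [RHS]/=.
rewrite /descent !(ipDl, ipDr, ipNl, ipNr, ipZl, ipZr_real).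
by rewrite TP adjoint_sym.
Qed.

Lemma descent_range m v : exists z, iter m descent v = v - T z.
Proof.
elim: m => [|m [z zE]] /=.
  by exists 0; rewrite -(scale0r (0 : X)) TZ scale0r subr0.
exists (z + rc s *: Ts (iter m descent v)).
by rewrite {1}/descent {1}zE TD TZ opprD addrA.
Qed.

(** The energy identity without its positive [Ts] term. Slow growth is enough, as [m s^2 M] will be
    kept below 1/2. *)
Lemma descent_growth m v :
  q (ip (iter m descent v) (iter m descent v)) <=
  (1 + s ^+ 2 * M) ^+ m * q (ip v v).
Proof.
elim: m => [|m IH]; first by rewrite expr0 mul1r.
have s2 : 0 <= s ^+ 2 by exact: sqr_ge0.
rewrite exprS -mulrA iterS; move: IH; set u := iter m descent v => IH.
have step : q (ip (descent u) (descent u)) <= (1 + s ^+ 2 * M) * q (ip u u).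
  apply: le_trans (P_mono (P_ip _) (P_Z _ (P_ip (Ts u)))) _.
    by apply: (_ : 0 <= 2 * s); rewrite mulr_ge0 // ltW.
  rewrite ip_descent; apply: le_trans (cs_D qP _ _) _; rewrite (cs_Zr_ge0 qP) //.
  by rewrite mulrDl mul1r lerD2l -mulrA ler_wpM2l // TTs_bound.
apply: le_trans step _; rewrite ler_wpM2l //.
by rewrite addr_ge0 // mulr_ge0 // sqr_ge0.
Qed.

Lemma descent_telescope m v :
  let u k := iter k descent v in
  ip (u m) (u m) + rc (2 * s) *: \sum_(k < m) ip (Ts (u k)) (Ts (u k)) =
  ip v v + rc (s ^+ 2) *: \sum_(k < m) ip (T (Ts (u k))) (T (Ts (u k))).
Proof.
move=> u; elim: m => [|m IH]; first by rewrite !big_ord0 !scaler0.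
rewrite !big_ord_recr /= !scalerDr addrCA ip_descent addrA [RHS]addrA.
by congr (_ + _); rewrite -IH addrC.
Qed.

Lemma descent_sum_bound m v : m%:R * (s ^+ 2 * M) <= 2^-1 ->
  q (\sum_(k < m) ip (Ts (iter k descent v)) (Ts (iter k descent v))) <=
  q (ip v v) / s.
Proof.
move=> mM; set U := q (ip v v); set S := \sum_(k < m) _.
have U0 : 0 <= U by exact: cs_ge0 qP _.
have y0 : 0 <= s ^+ 2 * M by rewrite mulr_ge0 ?sqr_ge0.
rewrite ler_pdivlMr //.
have PS : P (rc (2 * s) *: S).
  apply: P_Z; first by rewrite mulr_ge0 // ltW.
  by apply: (@P_sum m (fun k => ip (Ts (iter k descent v)) (Ts (iter k descent v)))).
have := P_mono PS (P_ip (iter m descent v)).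
have tel := descent_telescope m v; rewrite /= -/S in tel.
rewrite [rc (2 * s) *: S + _]addrC tel (cs_Zr_ge0 qP) ?mulr_ge0 ?(ltW s_gt0) //.
set S' := \sum_(k < m) _ => H.
(* Under the bound on [m], every iterate has energy at most [2 U], so [s^2 S'] contributes at most
   [U] to the telescoped identity. *)
have HS' : q S' <= m%:R * (M * (2 * U)).
  have Hk k : (k <= m)%N ->
      q (ip (T (Ts (iter k descent v))) (T (Ts (iter k descent v)))) <= M * (2 * U).
    move=> km; apply: le_trans (TTs_bound _) _; rewrite ler_wpM2l ?sqr_ge0 //.
    apply: le_trans (descent_growth _ _) _; rewrite ler_wpM2r //.
    apply: le_trans (expr1D_le2 y0 mM km) _.
    have : k%:R * (s ^+ 2 * M) <= 2^-1.
      by apply: le_trans mM; rewrite ler_wpM2r // ler_nat.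
    by lra.
  rewrite /S'; elim: (m) Hk => [|j IHj] Hk; first by rewrite big_ord0 (cs_0 qP) mul0r.
  rewrite big_ord_recr -natr1 mulrDl mul1r; apply: le_trans (cs_D qP _ _) _.
  by apply: lerD; [apply: IHj => k kj; apply: Hk; exact: leqW|exact: Hk].
have := cs_D qP (ip v v) (rc (s ^+ 2) *: S'); rewrite (cs_Zr_ge0 qP) ?sqr_ge0 // -/U.
have := ler_wpM2l (sqr_ge0 s) HS'; have := ler_wpM2r U0 mM.
by lra.
Qed.

(** The average of the first [n] iterates has the form [K x - T z]. The fourth power comes from two
    uses of [jensen], on the [u k] and on the [Ks (u (2 k))], linked by Cauchy-Schwarz. *)
Lemma descent_average n x : (0 < n)%N -> n.*2%:R * (s ^+ 2 * M) <= 2^-1 ->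
  exists z, nq (K x - T z) ^+ 4 * (s * n%:R) <=
    16 * nq x ^+ 2 * (Bup / Alo * q (ip (K x) (K x))).
Proof.
move=> n0 nM; set U := q (ip (K x) (K x)).
have U0 : 0 <= U by exact: cs_ge0 qP _.
pose u k := iter k descent (K x).
pose a k := ip (Ts (u k)) (Ts (u k)); pose b k := ip (Ks (u k)) (Ks (u k)).
have H1 : q (\sum_(k < n.*2) a k) <= U / s by exact: descent_sum_bound.
set B := q (\sum_(k < n) b k.*2).
have H2 : Alo * B <= Bup * (U / s).
  apply: le_trans (ler_wpM2l (ltW Bup_gt0) H1).
  rewrite -!(cs_Zr_ge0 qP) ?(ltW Alo_gt0) ?(ltW Bup_gt0) //; apply: P_mono_sub.
    by apply: P_Z; [exact: ltW|apply: (@P_sum n (fun k => b k.*2)) => k; exact: P_ip].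
  have -> : rc Bup *: (\sum_(k < n.*2) a k) - rc Alo *: (\sum_(k < n) b k.*2) =
      rc Bup *: (\sum_(k < n.*2) a k - \sum_(k < n) a k.*2) +
      \sum_(k < n) (rc Bup *: a k.*2 - rc Alo *: b k.*2).
    rewrite sumrB -!scaler_sumr; move: (\sum_(k < n.*2) _) => z1.
    by move: (\sum_(k < n) _) (\sum_(k < n) _) => z2 z3; lmod A.
  apply: P_D; last first.
    by apply: (@P_sum n (fun k => rc Bup *: a k.*2 - rc Alo *: b k.*2)) => k; exact: KT.
  by apply: P_Z; [exact: ltW|apply: sum_even_le => k; exact: P_ip].
have H3 : \sum_(k < n) ip (u k) (u k) = ip x (\sum_(k < n) Ks (u k.*2)).
  rewrite (@ip_sumr _ _ (fun k => Ks (u k.*2))); apply: eq_bigr => k _.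
  by rewrite {1}/u descent_sym KP /u -iterD addnn.
have H4 := q_ip_le x (\sum_(k < n) Ks (u k.*2)).
have H5 := jensen n (fun k => Ks (u k.*2)).
have H6 := jensen n u; rewrite H3 in H6.
have [z zE] : exists z, \sum_(k < n) u k = rc (n%:R : R) *: K x - T z.
  elim: (n) => [|m [z zE]].
    by exists 0; rewrite big_ord0 -(scale0r (0 : X)) TZ !scale0r subrr.
  have [y yE] := descent_range m (K x).
  exists (z + y); rewrite big_ord_recr /= zE {1}/u yE TD -natr1.
  by move: (T z) (T y) (K x) => c1 c2 c3; move: (m%:R) => r; lmod X.
have nR : 0 < n%:R :> R by rewrite ltr0n.
exists (rc (n%:R^-1 : R) *: z).
have -> : K x - T (rc (n%:R^-1 : R) *: z) = rc (n%:R^-1 : R) *: \sum_(k < n) u k.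
  by rewrite zE scalerBr scalerA -rmorphM mulVf ?gt_eqF // scale1r TZ.
rewrite nqZ ?invr_ge0 ?ler0n // exprMn.
move: H4 H5 H6; rewrite -/B; set g := q _; set k1 := nq (\sum_(k < n) Ks _).
set a0 := nq (\sum_(k < n) u k); move: (n%:R) nR => N nR H4 H5 H6.
have [x0 k0] : 0 <= nq x /\ 0 <= k1 by split; exact: nq_ge0.
have g0 : 0 <= g by exact: cs_ge0 qP _.
have B0 : 0 <= B by exact: cs_ge0 qP _.
have H7 : a0 ^+ 4 <= (N * g) ^+ 2.
  by rewrite (exprM _ 2 2) lerXn2r ?nnegrE ?sqr_ge0 // mulr_ge0 // ltW.
have H8 : g ^+ 2 <= (4 * (nq x * k1)) ^+ 2.
  by rewrite lerXn2r ?nnegrE // mulr_ge0 // mulr_ge0.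
have H9 : s * B <= Bup / Alo * U.
  rewrite [leRHS]mulrAC ler_pdivlMr //; move: H2; rewrite mulrA ler_pdivlMr //.
  by have -> : s * B * Alo = Alo * B * s by ring.
have H10 : a0 ^+ 4 * s <= N ^+ 3 * (16 * nq x ^+ 2 * (Bup / Alo * U)).
  apply: le_trans (_ : N ^+ 2 * (16 * nq x ^+ 2 * (N * B)) * s <= _).
    rewrite ler_pM2r //; apply: le_trans H7 _; rewrite exprMn ler_wpM2l ?sqr_ge0 //.
    apply: le_trans H8 _; have -> : (4 * (nq x * k1)) ^+ 2 = 16 * nq x ^+ 2 * k1 ^+ 2 by ring.
    by rewrite ler_wpM2l // mulr_ge0 // sqr_ge0.
  have -> : N ^+ 2 * (16 * nq x ^+ 2 * (N * B)) * s =
    N ^+ 3 * (16 * nq x ^+ 2 * (s * B)) by ring.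
  by rewrite !ler_wpM2l ?exprn_ge0 ?(ltW nR) // mulr_ge0 // sqr_ge0.
have -> : N^-1 ^+ 4 * a0 ^+ 4 * (s * N) = a0 ^+ 4 * s / N ^+ 3.
  by field; rewrite gt_eqF.
by rewrite ler_pdivrMr ?exprn_gt0 // [leRHS]mulrC.
Qed.

End Descent.

Lemma range_approx x e : 0 < e -> exists z, nq (K x - T z) < e.
Proof.
move=> e0; set C := 16 * nq x ^+ 2 * (Bup / Alo * q (ip (K x) (K x))).
have C0 : 0 <= C.
  apply: mulr_ge0; first by rewrite mulr_ge0 ?sqr_ge0.
  by apply: mulr_ge0; [exact/ltW/divr_gt0|exact: cs_ge0 qP _].
have e4 : 0 < e ^+ 4 by rewrite exprn_gt0.
(* With step [s = L / n] the product [s n] stays equal to [L], large enough that [C / L < e ^+ 4],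
   while [2 n s^2 M = 2 M L^2 / n] drops to 1/2 once [n >= 4 M L^2]. *)
pose L := C / e ^+ 4 + 1; have L0 : 0 < L by rewrite ltr_wpDl // divr_ge0 // ltW.
have M0 : 0 <= M by exact: sqr_ge0.
pose n := (Num.bound (4 * (M * L ^+ 2))).+1.
have nR : 0 < n%:R :> R by rewrite ltr0n.
have nL : 4 * (M * L ^+ 2) <= n%:R.
  apply/ltW; apply: lt_trans (archi_boundP _) _; last by rewrite ltr_nat.
  by rewrite mulr_ge0 // mulr_ge0 // sqr_ge0.
have s0 : 0 < L / n%:R by rewrite divr_gt0.
have [||z] := @descent_average _ s0 n x; first by [].
  have -> : n.*2%:R * ((L / n%:R) ^+ 2 * M) = 2 * (M * L ^+ 2) / n%:R.
    by rewrite -muln2 natrM; field; rewrite gt_eqF.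
  by rewrite ler_pdivrMr //; lra.
rewrite divfK ?gt_eqF // -/C => H; exists z; rewrite ltNge; apply/negP => le.
have le4 : e ^+ 4 <= nq (K x - T z) ^+ 4.
  by rewrite lerXn2r ?nnegrE ?nq_ge0 // ltW.
have : C < e ^+ 4 * L by rewrite mulrDr mulr1 mulrC divfK ?gt_eqF // ltrDl.
have := ler_wpM2r (ltW L0) le4; lra.
Qed.

End Adjoint.
End InnerProduct.

(** * Comparison of frame sums, and the theorem *)

Lemma sum_converges_unique (R : realType) (A : lmodType R[i]) mul star
  (S : Type) (p : S -> A -> R) (I : countType) (f g : I -> A) s t :
  is_pro_cstar_algebra mul star p ->
  sum_converges_to mul star p f s -> sum_converges_to mul star p g t ->
  f =1 g -> s = t.
Proof.
move=> [HA _ [sep _]] fs gt fg; apply/eqP; rewrite -subr_eq0; apply/eqP.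
apply: sep => q Hq; have [qP _] := Hq.
apply/le_anti; rewrite (cs_ge0 qP) andbT; apply/ler_addgt0Pr => e e0.
have e2 : 0 < e / 2 by rewrite divr_gt0.
have [F1 H1] := fs q Hq _ e2; have [F2 H2] := gt q Hq _ e2.
pose F := undup (F1 ++ F2).
have {}H1 : q (\sum_(i <- F) f i - s) < e / 2.
  by apply: H1; rewrite ?undup_uniq // => i iF; rewrite mem_undup mem_cat iF.
have {}H2 : q (\sum_(i <- F) f i - t) < e / 2.
  rewrite (eq_bigr g) => [|i _]; last exact: fg.
  by apply: H2; rewrite ?undup_uniq // => i iF; rewrite mem_undup mem_cat iF orbT.
have -> : s - t = (\sum_(i <- F) f i - t) - (\sum_(i <- F) f i - s).
  by move: (\sum_(i <- F) _) => z; lmod A.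
by apply: le_trans (cs_B qP _ _) _; rewrite add0r; lra.
Qed.

Theorem theorem4p10 (R : realType) (A : lmodType R[i]) (mul : A -> A -> A)
  (star : A -> A) (S : Type) (p : S -> A -> R)
  (X : lmodType R[i]) (act : A -> X -> X) (ip : X -> X -> A)
  (K Ks T : X -> X) (I : countType) (xi : I -> X) :
  is_pro_cstar_algebra mul star p ->
  is_hilbert_module mul star p act ip ->
  in_Hom mul star p act ip K -> is_adjoint ip K Ks ->
  unif_bounded mul star p ip K -> dense_range mul star p ip K ->
  is_K_frame mul star p ip K Ks xi ->
  in_Hom mul star p act ip T -> unif_bounded mul star p ip T ->
  closed_range mul star p ip T ->
  is_K_frame mul star p ip K Ks (fun i => T (xi i)) ->
  forall y : X, exists x : X, T x = y.
Proof.
move=> HPA HX _ KP _ Kdense Fxi [TD TZ _ _ [Ts TP]] [c [c0 Tc]] Tclosed FTxi y.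
have [HA _ _] := HPA.
have [_ [[ipDl ipZl _ ipC] ip_pos _] _] := HX.
have [Alo' [Bup [_ [Bup0 HB]]]] := Fxi.
have [Alo [Bup' [Alo0 [_ HAlo]]]] := FTxi.
(* The sum for the image family at [v] has the same terms as the sum for [xi] at [Ts v], so the
   lower bound of one and the upper bound of the other concern the same element. *)
have frame v : exists s, leA mul star (rc Alo *: ip (Ks v) (Ks v)) s /\
    leA mul star s (rc Bup *: ip (Ts v) (Ts v)).
  have [s [cs lo _]] := HAlo v; have [t [ct _ up]] := HB (Ts v).
  exists s; split=> //; suff -> : s = t by [].
  apply: sum_converges_unique HPA cs ct _ => i.
  by rewrite TP -ipC TP ipC.
apply: Tclosed => q Hq e e0; have [qP _] := Hq.
have [P [Psq PD PZ Pmono]] := cstar_positive_cone HA qP.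
have Pip x : P (ip x x) by have [b ->] := ip_pos x; exact: Psq.
have KT v : P (rc Bup *: ip (Ts v) (Ts v) - rc Alo *: ip (Ks v) (Ks v)).
  have [s [[a aE] [b bE]]] := frame v.
  have -> : rc Bup *: ip (Ts v) (Ts v) - rc Alo *: ip (Ks v) (Ks v) =
    (rc Bup *: ip (Ts v) (Ts v) - s) + (s - rc Alo *: ip (Ks v) (Ks v)).
    by rewrite addrA subrK.
  by rewrite aE bE; apply: PD; exact: Psq.
have e2 : 0 < e / 2 by rewrite divr_gt0.
(* Density gives [K x] near [y], and the descent gives [T z] near [K x], both for the fixed seminorm
   [q]. *)
have [_ [[x <-] yx]] := Kdense y q Hq _ e2.
have [z xz] := range_approx HA qP ipDl ipZl ipC Pip PD PZ Pmono TD TZ TP c0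
  (Tc q Hq) KP Alo0 Bup0 KT x e2.
exists (T z); split; first by exists z.
have nsq v : qX ip q v ^+ 2 = q (ip v v) := nq_sq ip qP v.
have n0 v : 0 <= qX ip q v := sqrtr_ge0 _.
rewrite -(@ltr_pXn2r _ 2) ?nnegrE ?(ltW e0) // nsq.
have -> : y - T z = (y - K x) + (K x - T z) by rewrite addrA subrK.
(* In place of the triangle inequality for [qX]: two errors below [e / 2] give a square below
   [2 (e^2/4 + e^2/4) = e^2]. *)
apply: le_lt_trans (q_ip_add HA qP ipDl ipZl ipC Pip Pmono _ _) _.
rewrite -!nsq.
have H1 : qX ip q (y - K x) ^+ 2 < (e / 2) ^+ 2.
  by rewrite ltr_pXn2r ?nnegrE ?(ltW e2).
have H2 : qX ip q (K x - T z) ^+ 2 < (e / 2) ^+ 2.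
  by rewrite ltr_pXn2r ?nnegrE ?(ltW e2).
by move: H1 H2; rewrite expr_div_n; lra.
Qed.
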